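(* (Homotopy pushdown theorem.) Let $G$ be a finite group, let $S\colon\mathbf{D}\to\mathbf{C}$ be an equivariant functor between small $G$-categories, and let $F\colon\mathbf{D}\to s\mathbf{Set}$ be a right $G$-functor with action given by $\eta$. Let $S_{h_*}(F)\colon\mathbf{C}\to s\mathbf{Set}$ be the functor given by $C\mapsto B(F,\mathbf{D},\hom_{\mathbf{C}}(S-,C))$. Then $S_{h_*}(F)$ is a right $G$-functor (with the action induced by $\eta$ and by the $G$-actions on $\mathbf{D}$ and $\mathbf{C}$), and $\operatorname{hocolim}_{\mathbf{C}}S_{h_*}(F)$ and $\operatorname{hocolim}_{\mathbf{D}}F$ are $G$-homotopy equivalent: $$\operatorname{hocolim}_{\mathbf{C}}S_{h_*}(F)\simeq_G\operatorname{hocolim}_{\mathbf{D}}F.$$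
   Context: $s\mathbf{Set}$ is the category of simplicial sets, and $N$ denotes the nerve. A set is regarded as a (constant, discrete) simplicial set. A small $G$-category is a small category $\mathbf{C}$ with functors $g\colon\mathbf{C}\to\mathbf{C}$ ($g\in G$) such that the identity element acts as the identity functor and composition corresponds to multiplication in $G$; $\mathbf{C}^{\mathrm{op}}$ is then also a small $G$-category. A functor $S\colon\mathbf{D}\to\mathbf{C}$ between small $G$-categories is equivariant if $S(gD)=gS(D)$ and $S(g\phi)=gS(\phi)$ for all $g\in G$, objects $D$ and morphisms $\phi$ of $\mathbf{D}$. Right $G$-functor: a functor $F\colon\mathbf{A}\to\mathbf{E}$ from a small $G$-category $\mathbf{A}$ to a category $\mathbf{E}$, together with $\mathbf{E}$-maps $\eta_{g,X}\colon F(X)\to F(gX)$ for $g\in G$, $X\in\mathrm{obj}\,\mathbf{A}$, such that (1) $\eta_{1,X}=1_{F(X)}$; (2) $\eta_{g_1,g_2X}\circ\eta_{g_2,X}=\eta_{g_1g_2,X}$; (3) $\eta_{g,Y}\circ F(f)=F(gf)\circ\eta_{g,X}$ for every map $f\colon X\to Y$ in $\mathbf{A}$. Bar construction: for functors $F\colon\mathbf{D}\to s\mathbf{Set}$ and $T\colon\mathbf{D}^{\mathrm{op}}\to s\mathbf{Set}$, $B(F,\mathbf{D},T)$ is the simplicial set whose $n$-simplices are the tuples $(\phi_1,\ldots,\phi_n;x,t)$, where $X_0\xrightarrow{\phi_1}X_1\to\cdots\xrightarrow{\phi_n}X_n$ is an element of $N(\mathbf{D})_n$, $x\in F(X_0)_n$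 and $t\in T(X_n)_n$. Faces: $d^0(\phi_1,\ldots,\phi_n;x,t)=(\phi_2,\ldots,\phi_n;d^0(F(\phi_1)x),d^0t)$; $d^i(\phi_1,\ldots,\phi_n;x,t)=(\phi_1,\ldots,\phi_{i+1}\phi_i,\ldots,\phi_n;d^ix,d^it)$ for $1\le i\le n-1$; $d^n(\phi_1,\ldots,\phi_n;x,t)=(\phi_1,\ldots,\phi_{n-1};d^nx,d^n(T(\phi_n)t))$. Degeneracies: $s^i$ inserts $1_{X_i}$ between $\phi_i$ and $\phi_{i+1}$ and applies $s^i$ to $x$ and $t$. The functor $S_{h_*}(F)$: here $T=\hom_{\mathbf{C}}(S-,C)\colon\mathbf{D}^{\mathrm{op}}\to\mathbf{Set}\subset s\mathbf{Set}$, and a map $\psi\colon C\to C'$ in $\mathbf{C}$ acts by $(\phi_1,\ldots,\phi_n;x,f)\mapsto(\phi_1,\ldots,\phi_n;x,\psi f)$. The induced action maps are $S_{h_*}(F)(C)\to S_{h_*}(F)(gC)$, $(\phi_1,\ldots,\phi_n;x,f)\mapsto(g\phi_1,\ldots,g\phi_n;\eta_{g,X_0}(x),gf)$, where $f\colon S(X_n)\to C$ and $gf\colon S(gX_n)=gS(X_n)\to gC$. Tensor product: for right $G$-functors $F\colon\mathbf{C}\to s\mathbf{Set}$ (action $\eta^F$) and $T\colon\mathbf{C}^{\mathrm{op}}\to s\mathbf{Set}$ (action $\eta^T$), $F\otimes_{\mathbf{C}}T$ is the coend of $F\times T\colon\mathbf{C}\times\mathbf{C}^{\mathrm{op}}\to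 s\mathbf{Set}$, i.e. the quotient of $\coprod_{C}F(C)\times T(C)$ by the relations $(F(\phi)x,t)\sim(x,T(\phi)t)$ for $\phi\colon C\to C'$ in $\mathbf{C}$, $x\in F(C)_n$, $t\in T(C')_n$; it is a $G$-simplicial set via $g[x,t]=[\eta^F_{g,C}(x),\eta^T_{g,C}(t)]$ for $x\in F(C)_n$, $t\in T(C)_n$. Homotopy colimit: for an object $X$ of a small $G$-category $\mathbf{C}$ let $X\backslash\mathbf{C}$ be the category with objects the maps $u\colon X\to C$ in $\mathbf{C}$ and with morphisms from $u\colon X\to C$ to $u'\colon X\to C'$ the maps $p\colon C\to C'$ with $pu=u'$. Then $X\mapsto N(X\backslash\mathbf{C})$ is a functor $\mathbf{C}^{\mathrm{op}}\to s\mathbf{Set}$ (by precomposition), and a right $G$-functor via $u\mapsto gu$. For a right $G$-functor $F\colon\mathbf{C}\to s\mathbf{Set}$, $\operatorname{hocolim}_{\mathbf{C}}F=F\otimes_{\mathbf{C}}N(-\backslash\mathbf{C})$, with its $G$-action. Two $G$-simplicial sets are $G$-homotopy equivalent ($\simeq_G$) if their geometric realizations are $G$-homotopy equivalent as $G$-spaces, i.e. there are $G$-maps in both directions whose composites are $G$-equivariantly homotopic to the identities (with $G$ acting trivially on $[0,1]$). *)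

(* Defs.v *)
From HB Require Import structures.
From Stdlib Require Import Relation_Operators.
From mathcomp Require Import all_boot all_order all_algebra all_fingroup.
From mathcomp Require Import all_classical all_reals topology normedtype.
From mathcomp Require Import generic_quotient.
Import Order.TTheory GRing.Theory Num.Theory.
Import numFieldNormedType.Exports.

Set Implicit Arguments.
Unset Strict Implicit.
Unset Printing Implicit Defensive.

Local Obligation Tactic := idtac.

Lemma sig_eq (T : Type) (P : T -> Prop) (a b : {x | P x}) :
  proj1_sig a = proj1_sig b -> a = b.
Proof.
case: a b => [x px] [y py] /= e; case: _ / e in py *.
by rewrite (Prop_irrelevance px py).
Qed.

Record category := Category {
  obj :> Type;
  hom : obj -> obj -> Type;
  idm : forall X, hom X X;
  compm : forall X Y Z, hom Y Z -> hom X Y -> hom X Z;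
  comp1m : forall X Y (f : hom X Y), compm (idm Y) f = f;
  compm1 : forall X Y (f : hom X Y), compm f (idm X) = f;
  compmA : forall X Y Z W (h : hom Z W) (g : hom Y Z) (f : hom X Y),
    compm h (compm g f) = compm (compm h g) f }.

Arguments hom {c} _ _.
Arguments idm {c} X.
Arguments compm {c X Y Z} _ _.
Notation "g \oc f" := (compm g f) (at level 50, left associativity).

(* The identity morphism, with its codomain rewritten along an equality of
   objects; G-categories satisfy their axioms strictly, so morphisms whose
   endpoints are only propositionally equal are composed through it. *)
Definition eqhom (C : category) (X Y : C) (e : X = Y) : hom X Y :=
  match e in _ = Z return hom X Z with erefl => idm X end.

Lemma eqhom1 (C : category) (X : C) (e : X = X) : eqhom e = idm X.
Proof. by rewrite (Prop_irrelevance e erefl). Qed.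

Record functor (C D : category) := Functor {
  fob :> C -> D;
  fmor : forall X Y : C, hom X Y -> hom (fob X) (fob Y);
  fmor1 : forall X, fmor (idm X) = idm (fob X);
  fmorM : forall X Y Z (g : hom Y Z) (f : hom X Y),
    fmor (g \oc f) = fmor g \oc fmor f }.

Lemma functor_eq (C D : category) (F F' : functor C D)
    (e : forall X, F X = F' X) :
  (forall X Y (f : hom X Y),
    eqhom (e Y) \oc fmor F f = fmor F' f \oc eqhom (e X)) -> F = F'.
Proof.
case: F F' e => [o m m1 mM] [o' m' m1' mM'] /= e.
have E : o = o' by apply: funext.
case: _ / E in m' m1' mM' e * => me.
suff E : m = m'.
  case: _ / E in m1' mM' me *.
  by rewrite (Prop_irrelevance m1 m1') (Prop_irrelevance mM mM').
apply: functional_extensionality_dep => X.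
apply: functional_extensionality_dep => Y; apply: funext => f.
by have := me X Y f; rewrite !eqhom1 comp1m compm1.
Qed.

Lemma functor_eq_refl (C D : category) (o : C -> D)
    (m : forall X Y : C, hom X Y -> hom (o X) (o Y)) m1 mM m1' mM' :
  @Functor C D o m m1 mM = @Functor C D o m m1' mM'.
Proof. by rewrite (Prop_irrelevance m1 m1') (Prop_irrelevance mM mM'). Qed.

Definition functor_ob_eq (C D : category) (F F' : functor C D) (e : F = F')
  (X : C) : F X = F' X := f_equal (fun H : functor C D => H X) e.

Lemma functor_hom_eq (C D : category) (F F' : functor C D) (e : F = F')
    (X Y : C) (f : hom X Y) :
  eqhom (functor_ob_eq e Y) \oc fmor F f =
  fmor F' f \oc eqhom (functor_ob_eq e X).
Proof. by case: _ / e; rewrite /= comp1m compm1. Qed.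

Definition idF (C : category) : functor C C :=
  @Functor C C id (fun _ _ f => f) (fun=> erefl) (fun _ _ _ _ _ => erefl).

Program Definition compF (C D E : category) (K : functor D E)
    (H : functor C D) : functor C E :=
  @Functor C E (fun X => K (H X)) (fun _ _ f => fmor K (fmor H f)) _ _.
Next Obligation. by move=> * /=; rewrite !fmor1. Qed.
Next Obligation. by move=> * /=; rewrite !fmorM. Qed.

Definition op (C : category) : category :=
  @Category C (fun X Y => @hom C Y X) (fun X => @idm C X)
    (fun X Y Z g f => @compm C Z Y X f g)
    (fun X Y f => @compm1 C Y X f) (fun X Y f => @comp1m C Y X f)
    (fun X Y Z W h g f => esym (@compmA C W Z Y X f g h)).

Definition opF (C D : category) (F : functor C D) : functor (op C) (op D) :=
  @Functor (op C) (op D) (fob F) (fun X Y f => @fmor C D F Y X f)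
    (fun X => fmor1 F X) (fun X Y Z g f => @fmorM C D F Z Y X f g).

Program Definition undercat (C : category) (X : C) : category :=
  @Category {Y : C & hom X Y}
    (fun u v => {p : hom (projT1 u) (projT1 v) | p \oc projT2 u = projT2 v})
    (fun u => exist _ (idm _) _)
    (fun u v w q p => exist _ (proj1_sig q \oc proj1_sig p) _) _ _ _.
Next Obligation. by move=> * /=; rewrite comp1m. Qed.
Next Obligation.
by move=> C X u v w [q /= eq_q] [p /= eq_p]; rewrite -compmA eq_p.
Qed.
Next Obligation. by move=> *; apply: sig_eq; rewrite /= comp1m. Qed.
Next Obligation. by move=> *; apply: sig_eq; rewrite /= compm1. Qed.
Next Obligation. by move=> *; apply: sig_eq; rewrite /= compmA. Qed.

Program Definition under_pre (C : category) (X X' : C) (f : hom X X') :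
    functor (undercat X') (undercat X) :=
  @Functor (undercat X') (undercat X)
    (fun u => existT _ (projT1 u) (projT2 u \oc f))
    (fun u v p => exist _ (proj1_sig p) _) _ _.
Next Obligation. by move=> C X X' f u v [p /= eq_p]; rewrite compmA eq_p. Qed.
Next Obligation. by move=> *; apply: sig_eq. Qed.
Next Obligation. by move=> *; apply: sig_eq. Qed.

Program Definition under_map (C D : category) (F : functor C D) (X : C) :
    functor (undercat X) (undercat (F X)) :=
  @Functor (undercat X) (undercat (F X))
    (fun u => existT _ (F (projT1 u)) (fmor F (projT2 u)))
    (fun u v p => exist _ (fmor F (proj1_sig p)) _) _ _.
Next Obligation. by move=> C D F X u v [p /= <-]; rewrite fmorM. Qed.
Next Obligation. by move=> *; apply: sig_eq; rewrite /= fmor1. Qed.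
Next Obligation. by move=> *; apply: sig_eq; rewrite /= fmorM. Qed.

Program Definition ordcat (n : nat) : category :=
  @Category 'I_n.+1 (fun i j => (i <= j)%N) (fun i => leqnn i)
    (fun i j k jk ij => leq_trans ij jk) _ _ _.
Next Obligation. by move=> * /=; exact: Prop_irrelevance. Qed.
Next Obligation. by move=> * /=; exact: Prop_irrelevance. Qed.
Next Obligation. by move=> * /=; exact: Prop_irrelevance. Qed.

Record smor (m n : nat) := SMor {
  smor_fun :> 'I_m.+1 -> 'I_n.+1;
  smor_homo : forall i j : 'I_m.+1, (i <= j)%N -> (smor_fun i <= smor_fun j)%N }.

Definition smor_id (n : nat) : smor n n := @SMor n n id (fun _ _ => id).

Definition smor_comp (l m n : nat) (b : smor m n) (a : smor l m) : smor l n :=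
  @SMor l n (fun i => b (a i)) (fun i j ij => smor_homo b (smor_homo a ij)).

Record sSet := SSet {
  simp :> nat -> Type;
  sop : forall m n, smor m n -> simp n -> simp m;
  sop_id : forall n (x : simp n), sop (smor_id n) x = x;
  sop_comp : forall l m n (b : smor m n) (a : smor l m) (x : simp n),
    sop (smor_comp b a) x = sop a (sop b x) }.

Arguments sop {s m n} _ _.

Record smap (X Y : sSet) := SMap {
  smap_fun :> forall n, X n -> Y n;
  smap_nat : forall m n (a : smor m n) (x : X n),
    smap_fun (sop a x) = sop a (smap_fun x) }.

Arguments smap_fun {X Y} s n _.

Definition discrete_sSet (T : Type) : sSet :=
  @SSet (fun=> T) (fun _ _ _ x => x) (fun _ _ => erefl)
    (fun _ _ _ _ _ _ => erefl).

Program Definition ordF (m n : nat) (a : smor m n) :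
    functor (ordcat m) (ordcat n) :=
  @Functor (ordcat m) (ordcat n) (smor_fun a) (fun i j => @smor_homo m n a i j)
    _ _.
Next Obligation. by move=> * /=; exact: Prop_irrelevance. Qed.
Next Obligation. by move=> * /=; exact: Prop_irrelevance. Qed.

(* An n-simplex X_0 -> ... -> X_n of the nerve is a functor s : [n] -> C, with
   phi_i = fmor s (i-1 <= i). *)
Program Definition nerve (C : category) : sSet :=
  @SSet (fun n => functor (ordcat n) C) (fun m n a s => compF s (ordF a)) _ _.
Next Obligation. by move=> C n [o m m1 mM]; exact: functor_eq_refl. Qed.
Next Obligation.
move=> C l m n b a [o p m1 mM]; rewrite /compF /=.
suff E : forall (q q' : forall X Y : ordcat l, hom X Y ->
    hom (o (b (a X))) (o (b (a Y)))) q1 qM q1' qM', q = q' ->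
  @Functor (ordcat l) C _ q q1 qM = @Functor (ordcat l) C _ q' q1' qM'.
  by apply: E.
by move=> q q' q1 qM q1' qM' E; case: _ / E q1' qM' => *; exact: functor_eq_refl.
Qed.

Program Definition nerve_map (C D : category) (F : functor C D) :
    smap (nerve C) (nerve D) :=
  @SMap (nerve C) (nerve D) (fun n s => compF F s) _.
Next Obligation. by move=> * /=; exact: functor_eq_refl. Qed.

Record sfunctor (C : category) := SFunctor {
  sf_ob :> C -> sSet;
  sf_map : forall X Y : C, hom X Y -> smap (sf_ob X) (sf_ob Y);
  sf_map1 : forall X n (x : sf_ob X n), sf_map (idm X) n x = x;
  sf_mapM : forall X Y Z (g : hom Y Z) (f : hom X Y) n (x : sf_ob X n),
    sf_map (g \oc f) n x = sf_map g n (sf_map f n x) }.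

Arguments sf_map {C} s {X Y} _.

Lemma bar_eq (D : category) (F : sfunctor D) (T : sfunctor (op D)) n
    (s s' : nerve D n) (e : s = s') (i j : 'I_n.+1)
    (x : F (s i) n) (x' : F (s' i) n) (t : T (s j) n) (t' : T (s' j) n) :
  sf_map F (eqhom (functor_ob_eq e i)) n x = x' ->
  sf_map T (@eqhom (op D) _ _ (functor_ob_eq e j)) n t = t' ->
  existT (fun s : nerve D n => F (s i) n * T (s j) n)%type s (x, t) =
  existT (fun s : nerve D n => F (s i) n * T (s j) n)%type s' (x', t').
Proof. by case: _ / e in x' t' *; rewrite /= !sf_map1 => <- <-. Qed.

Lemma nerve_mor_irr (D : category) n (s : nerve D n) (i j : ordcat n)
  (p q : hom i j) : fmor s p = fmor s q.
Proof. by rewrite (Prop_irrelevance (p : is_true _) q). Qed.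

Lemma nerve_mor1 (D : category) n (s : nerve D n) (i : 'I_n.+1)
  (p : (i <= i)%N) : fmor s (p : @hom (ordcat n) i i) = idm (s i).
Proof. by rewrite -fmor1; congr (fmor s _) => /=; exact: Prop_irrelevance. Qed.

Section Bar.
Variables (D : category) (F : sfunctor D) (T : sfunctor (op D)).

Definition bar_simp (n : nat) : Type :=
  {s : nerve D n & F (s ord0) n * T (s ord_max) n}%type.

(* For the i-th face a : [n-1] -> [n], the map s(0 <= a 0) is phi_1 if i = 0 and
   an identity otherwise, and s(a (n-1) <= n) is phi_n if i = n and an identity
   otherwise; for a degeneracy both are identities. *)
Definition bar_sop m n (a : smor m n) (z : bar_simp n) : bar_simp m :=
  let s := projT1 z in
  let x := (projT2 z).1 in
  let t := (projT2 z).2 in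
  existT (fun s : nerve D m => F (s ord0) m * T (s ord_max) m)%type
    (sop a s)
    (sf_map F (fmor s (leq0n (a ord0) : @hom (ordcat n) ord0 (a ord0))) m
       (sop a x),
     sf_map T (fmor s (leq_ord (a ord_max) :
                         @hom (ordcat n) (a ord_max) ord_max)) m (sop a t)).

Program Definition bar : sSet := @SSet bar_simp bar_sop _ _.
Next Obligation.
move=> n [s [x t]]; apply: (bar_eq (e := sop_id s)) => /=.
  have -> : eqhom (functor_ob_eq (sop_id s) ord0) = idm (s ord0).
    exact: (eqhom1 (C := D)).
  by rewrite sf_map1 nerve_mor1 sf_map1 sop_id.
have -> : @eqhom (op D) _ _ (functor_ob_eq (sop_id s) ord_max) =
  idm (s ord_max : op D) by exact: (eqhom1 (C := op D)).
by rewrite sf_map1 nerve_mor1 (@sf_map1 (op D) T) sop_id.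
Qed.
Next Obligation.
move=> l m n b a [s [x t]]; apply: (bar_eq (e := sop_comp b a s)) => /=.
  have -> : eqhom (functor_ob_eq (sop_comp b a s) ord0) =
    idm (s (b (a ord0))) by exact: (eqhom1 (C := D)).
  rewrite sf_map1 sop_comp -smap_nat -sf_mapM -fmorM.
  by rewrite (@nerve_mor_irr D n s ord0 (b (a ord0)) _ (leq0n (b (a ord0)))).
have -> : @eqhom (op D) _ _ (functor_ob_eq (sop_comp b a s) ord_max) =
  idm (s (b (a ord_max)) : op D) by exact: (eqhom1 (C := op D)).
rewrite sf_map1 sop_comp -smap_nat -sf_mapM /= -fmorM.
by rewrite (@nerve_mor_irr D n s (b (a ord_max)) ord_max _ (leq_ord (b (a ord_max)))).
Qed.

End Bar.

Definition bar_mk (D : category) (F : sfunctor D) (T : sfunctor (op D)) n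
    (s : nerve D n) (x : F (s ord0) n) (t : T (s ord_max) n) : bar F T n :=
  existT _ s (x, t).

Record Gcategory (gT : finGroupType) := GCategory {
  gcat :> category;
  gact : gT -> functor gcat gcat;
  gact1 : gact 1%g = idF gcat;
  gactM : forall g h : gT, gact (g * h)%g = compF (gact g) (gact h) }.

Arguments gact {gT} _ _.

Section GCat.
Variable gT : finGroupType.

Definition gact1_ob (C : Gcategory gT) (X : C) : gact C 1%g X = X :=
  functor_ob_eq (gact1 C) X.

Definition gactM_ob (C : Gcategory gT) (g h : gT) (X : C) :
    gact C (g * h)%g X = gact C g (gact C h X) :=
  functor_ob_eq (gactM C g h) X.

Program Definition opG (C : Gcategory gT) : Gcategory gT :=
  @GCategory gT (op C) (fun g => opF (gact C g)) _ _.
Next Obligation. by move=> C /=; rewrite gact1; exact: functor_eq_refl. Qed.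
Next Obligation. by move=> C g h /=; rewrite gactM; exact: functor_eq_refl. Qed.

Definition equivariant (D C : Gcategory gT) (S : functor D C) : Prop :=
  forall g : gT, compF S (gact D g) = compF (gact C g) S.

(* Since gact C 1 X and X (resp. gact C (g h) X and gact C g (gact C h X)) are
   only propositionally equal, the first two axioms of a right G-functor compare
   the two sides through F applied to the identity morphism of this object. *)
Record is_right_Gfunctor (A : Gcategory gT) (F : sfunctor A)
    (eta : forall (g : gT) (X : A), smap (F X) (F (gact A g X))) : Prop := {
  eta1 : forall X n (x : F X n),
    sf_map F (eqhom (gact1_ob X)) n (eta 1%g X n x) = x;
  etaM : forall (g h : gT) X n (x : F X n),
    eta g (gact A h X) n (eta h X n x) =
    sf_map F (eqhom (gactM_ob g h X)) n (eta (g * h)%g X n x);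
  eta_nat : forall (g : gT) (X Y : A) (f : hom X Y) n (x : F X n),
    eta g Y n (sf_map F f n x) = sf_map F (fmor (gact A g) f) n (eta g X n x) }.

Record right_Gfunctor (A : Gcategory gT) := RightGFunctor {
  rg_fun :> sfunctor A;
  rg_eta : forall (g : gT) (X : A), smap (rg_fun X) (rg_fun (gact A g X));
  rg_axioms : is_right_Gfunctor rg_eta }.

Record GsSet := MkGsSet {
  gs_sset :> sSet;
  gs_act : gT -> smap gs_sset gs_sset;
  gs_act1 : forall n (x : gs_sset n), gs_act 1%g n x = x;
  gs_actM : forall (g h : gT) n (x : gs_sset n),
    gs_act (g * h)%g n x = gs_act g n (gs_act h n x) }.

End GCat.

Arguments rg_eta {gT A} r g X.
Arguments gs_act {gT} _ _.

Section Pushdown.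
Variables (D C : category) (S : functor D C) (F : sfunctor D).

Program Definition homS (c : C) : sfunctor (op D) :=
  @SFunctor (op D) (fun X => discrete_sSet (hom (S X) c))
    (fun X Y phi => @SMap (discrete_sSet (hom (S X) c))
      (discrete_sSet (hom (S Y) c)) (fun n f => f \oc fmor S phi) _) _ _.
Next Obligation. by []. Qed.
Next Obligation. by move=> c X n f /=; rewrite fmor1 compm1. Qed.
Next Obligation. by move=> c X Y Z g f n x /=; rewrite fmorM compmA. Qed.

Program Definition pushdown : sfunctor C :=
  @SFunctor C (fun c => bar F (homS c))
    (fun c c' psi => @SMap (bar F (homS c)) (bar F (homS c'))
      (fun n z => bar_mk (T := homS c') (projT2 z).1 (psi \oc (projT2 z).2)) _)
    _ _.
Next Obligation.
move=> c c' psi m n a [s [x f]]; congr existT; congr pair => /=.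
by rewrite compmA.
Qed.
Next Obligation.
by move=> c n [s [x f]]; congr existT; congr pair => /=; rewrite comp1m.
Qed.
Next Obligation.
move=> c c' c'' psi psi' n [s [x f]]; congr existT; congr pair => /=.
by rewrite compmA.
Qed.

End Pushdown.

Section PushdownAction.
Variables (gT : finGroupType) (D C : Gcategory gT) (S : functor D C).
Hypothesis hS : equivariant S.
Variable F : right_Gfunctor D.

(* The morphism gf : S(gX) = gS(X) -> gc. *)
Definition homS_act (g : gT) (X : D) (c : C) (f : hom (S X) c) :
    hom (S (gact D g X)) (gact C g c) :=
  fmor (gact C g) f \oc eqhom (functor_ob_eq (hS g) X).

Program Definition pushdown_eta (g : gT) (c : C) :
    smap (pushdown S F c) (pushdown S F (gact C g c)) :=
  @SMap (pushdown S F c) (pushdown S F (gact C g c))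
    (fun n z => bar_mk (F := F) (T := homS S (gact C g c))
      (s := nerve_map (gact D g) n (projT1 z))
      (rg_eta F g (projT1 z ord0) n (projT2 z).1)
      (homS_act g (projT2 z).2)) _.
Next Obligation.
move=> g c m n a [s [x f]]; rewrite /bar_mk /=.
have e : compF (gact D g) (sop a s : nerve D m) =
  sop a (compF (gact D g) s : nerve D n) :> functor _ _.
  exact: functor_eq_refl.
apply: (bar_eq (F := F) (T := homS S (gact C g c)) (e := e)) => /=.
  have -> : eqhom (functor_ob_eq e ord0) = idm (gact D g (s (a ord0))).
    exact: (eqhom1 (C := D)).
  by rewrite sf_map1 (eta_nat (rg_axioms F)) smap_nat.
have -> : @eqhom (op D) _ _ (functor_ob_eq e ord_max) =
  idm (gact D g (s (a ord_max)) : D) by exact: (eqhom1 (C := op D)).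
rewrite fmor1 compm1 /homS_act fmorM -!compmA; congr (_ \oc _).
exact: esym (functor_hom_eq (hS g) _).
Qed.

End PushdownAction.

Section Quot.
Variables (T : choiceType) (r : T -> T -> Prop).

Definition gen_rel : rel T := fun x y => `[< clos_refl_sym_trans T r x y >].

Lemma gen_rel_equiv : equiv_class_of gen_rel.
Proof.
split=> [x|x y|y x z].
- by apply/asboolP; exact: rst_refl.
- by apply/asboolP/asboolP; exact: rst_sym.
- by move=> /asboolP xy /asboolP yz; apply/asboolP; exact: rst_trans xy yz.
Qed.

Canonical gen_rel_equiv_rel := EquivRelPack gen_rel_equiv.

Definition quot := {eq_quot gen_rel}%qT.

Definition quot_pi (x : T) : quot := (\pi_quot x)%qT.

Lemma quot_eqP x y : quot_pi x = quot_pi y <-> clos_refl_sym_trans T r x y.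
Proof.
split=> [/eqP|xy]; last by apply/eqP; rewrite eqmodE; exact/asboolP.
by rewrite eqmodE => /asboolP.
Qed.

Lemma quot_eq x y : r x y -> quot_pi x = quot_pi y.
Proof. by move=> rxy; apply/quot_eqP; exact: rst_step. Qed.

Lemma quot_ind (P : quot -> Prop) : (forall x, P (quot_pi x)) -> forall q, P q.
Proof. by move=> Px q; rewrite -[q]reprK; exact: Px. Qed.

Definition quot_lift (U : Type) (f : T -> U) (q : quot) : U := f (repr q).

Lemma quot_liftE (U : Type) (f : T -> U) :
  (forall x y, r x y -> f x = f y) ->
  forall x, quot_lift f (quot_pi x) = f x.
Proof.
move=> rf x; have : quot_pi (repr (quot_pi x)) = quot_pi x by rewrite /quot_pi reprK.
by move=> /quot_eqP; rewrite /quot_lift; move: (repr _) => y; elim=> [u v /rf||u v _ ->|u v w _ -> _ ->].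
Qed.

End Quot.

Section Tensor.
Variables (C : category) (F : sfunctor C) (T : sfunctor (op C)).

Definition tensor_pre (n : nat) : Type := {c : C & F c n * T c n}%type.

Definition tpair n (c : C) (x : F c n) (t : T c n) : {classic (tensor_pre n)} :=
  existT (fun c : C => F c n * T c n)%type c (x, t).

Variant tensor_rel n : {classic (tensor_pre n)} -> {classic (tensor_pre n)} ->
    Prop :=
  TensorRel (c c' : C) (phi : hom c c') (x : F c n) (t : T c' n) :
    tensor_rel (tpair (sf_map F phi n x) t)
               (tpair x (sf_map T (phi : @hom (op C) c' c) n t)).

Lemma tpair_eq n (c c' : C) (e : c = c') (x : F c n) (t : T c n)
    (x' : F c' n) (t' : T c' n) :
  sf_map F (eqhom e) n x = x' -> sf_map T (@eqhom (op C) _ _ e) n t = t' ->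
  tpair x t = tpair x' t'.
Proof. by case: _ / e in x' t' *; rewrite /= !sf_map1 => <- <-. Qed.

Definition tensor_simp n : Type := quot (@tensor_rel n).

Definition tensor_pre_sop m n (a : smor m n) (z : {classic (tensor_pre n)}) :
    {classic (tensor_pre m)} :=
  tpair (sop a (projT2 z).1) (sop a (projT2 z).2).

Definition tensor_sop m n (a : smor m n) : tensor_simp n -> tensor_simp m :=
  quot_lift (fun z => quot_pi (@tensor_rel m) (tensor_pre_sop a z)).

Lemma tensor_sopE m n (a : smor m n) z :
  tensor_sop a (quot_pi (@tensor_rel n) z) =
  quot_pi (@tensor_rel m) (tensor_pre_sop a z).
Proof.
apply: quot_liftE => _ _ [c c' phi x t]; apply: quot_eq.
by rewrite /tensor_pre_sop /= -!smap_nat; exact: TensorRel.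
Qed.

Program Definition tensor : sSet := @SSet tensor_simp tensor_sop _ _.
Next Obligation.
move=> n; apply: quot_ind => -[c [x t]].
by rewrite tensor_sopE /tensor_pre_sop /= !sop_id.
Qed.
Next Obligation.
move=> l m n b a; apply: quot_ind => -[c [x t]].
by rewrite !tensor_sopE /tensor_pre_sop /= !sop_comp.
Qed.

End Tensor.

Section TensorAction.
Variables (gT : finGroupType) (C : Gcategory gT).
Variables (F : right_Gfunctor C) (T : right_Gfunctor (opG C)).

Local Notation F0 := (rg_fun F).
Local Notation T0 := (rg_fun T : sfunctor (op C)).

Definition tensor_pre_act (g : gT) n (z : {classic (tensor_pre F0 T0 n)}) :
    {classic (tensor_pre F0 T0 n)} :=
  tpair (F := F0) (T := T0) (rg_eta F g (projT1 z) n (projT2 z).1)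
    (rg_eta T g (projT1 z) n (projT2 z).2).

Definition tensor_act_fun (g : gT) n : tensor F0 T0 n -> tensor F0 T0 n :=
  quot_lift (fun z => quot_pi (@tensor_rel _ F0 T0 n) (tensor_pre_act g z)).

Lemma tensor_act_funE g n z :
  tensor_act_fun g (quot_pi (@tensor_rel _ F0 T0 n) z) =
  quot_pi (@tensor_rel _ F0 T0 n) (tensor_pre_act g z).
Proof.
apply: quot_liftE => _ _ [c c' phi x t]; apply: quot_eq.
rewrite /tensor_pre_act /= (eta_nat (rg_axioms F)) (eta_nat (rg_axioms T)).
exact: (@TensorRel _ F0 T0 n).
Qed.

Program Definition tensor_act (g : gT) : smap (tensor F0 T0) (tensor F0 T0) :=
  @SMap (tensor F0 T0) (tensor F0 T0) (tensor_act_fun g) _.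
Next Obligation.
move=> g m n a; apply: quot_ind => -[c [x t]] /=.
rewrite !(tensor_sopE, tensor_act_funE) /=.
by rewrite /tensor_pre_act /tensor_pre_sop /= !smap_nat.
Qed.

Program Definition tensorG : GsSet gT := @MkGsSet gT (tensor F0 T0) tensor_act _ _.
Next Obligation.
move=> n; apply: quot_ind => -[c [x t]] /=.
rewrite tensor_act_funE; congr quot_pi.
apply: (tpair_eq (F := F0) (T := T0) (e := gact1_ob c)).
  exact: (eta1 (rg_axioms F)).
rewrite (Prop_irrelevance (gact1_ob c) (gact1_ob (c : opG C))).
exact: (eta1 (rg_axioms T)).
Qed.
Next Obligation.
move=> g h n; apply: quot_ind => -[c [x t]] /=.
rewrite !tensor_act_funE; congr quot_pi.
apply: (tpair_eq (F := F0) (T := T0) (e := gactM_ob g h c)).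
  exact: esym (etaM (rg_axioms F) _ _ _).
rewrite (Prop_irrelevance (gactM_ob g h c) (gactM_ob g h (c : opG C))).
exact: esym (etaM (rg_axioms T) _ _ _).
Qed.

End TensorAction.

Lemma undercat_ob_eq (C : category) (X : C) (u v : undercat X)
    (e : projT1 u = projT1 v) : eqhom e \oc projT2 u = projT2 v -> u = v.
Proof.
case: u v e => [Y u] [Z v] /= e; case: _ / e v => v /=.
by rewrite comp1m => ->.
Qed.

Lemma undercat_eqhom (C : category) (X : C) (u v : undercat X) (e : u = v) :
  proj1_sig (eqhom e) = eqhom (f_equal (@projT1 _ _) e).
Proof. by case: _ / e. Qed.

Lemma undercat_functor_eq (J C : category) (X : C)
    (s s' : functor J (undercat X))
    (e : forall i, projT1 (s i) = projT1 (s' i)) :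
  (forall i, eqhom (e i) \oc projT2 (s i) = projT2 (s' i)) ->
  (forall i j (f : hom i j), eqhom (e j) \oc proj1_sig (fmor s f) =
     proj1_sig (fmor s' f) \oc eqhom (e i)) ->
  s = s'.
Proof.
move=> es ef; apply: (@functor_eq _ _ _ _ (fun i => undercat_ob_eq (es i))).
move=> i j f; apply: sig_eq => /=; rewrite !undercat_eqhom.
by rewrite !(Prop_irrelevance (f_equal _ _) (e _)).
Qed.

Lemma eqhom_opK (C : category) (X Y : C) (e e' : X = Y) :
  eqhom e \oc (@eqhom (op C) X Y e' : @hom C Y X) = idm Y.
Proof. by case: _ / e e' => e; rewrite (eqhom1 (C := op C)) /= comp1m. Qed.

Program Definition nerve_under (C : category) : sfunctor (op C) :=
  @SFunctor (op C) (fun X => nerve (@undercat C X))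
    (fun X Y f => nerve_map (@under_pre C Y X f)) _ _.
Next Obligation.
move=> C X n s.
apply: (@undercat_functor_eq _ C X (compF (under_pre (@idm C X)) s) s
  (fun=> erefl)).
  by move=> i /=; rewrite comp1m compm1.
by move=> i j f /=; rewrite comp1m compm1.
Qed.
Next Obligation.
move=> C X Y Z g f n s.
apply: (@undercat_functor_eq _ C Z
  (compF (@under_pre C Z X (@compm C Z Y X f g)) s)
  (compF (@under_pre C Z Y g) (compF (@under_pre C Y X f) s)) (fun=> erefl)).
  by move=> i /=; rewrite comp1m compmA.
by move=> i j p /=; rewrite comp1m compm1.
Qed.

Definition nerve_under_eta (gT : finGroupType) (C : Gcategory gT) (g : gT)
    (X : C) : smap (nerve_under C X) (nerve_under C (gact C g X)) :=
  nerve_map (under_map (gact C g) X).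

Lemma nerve_under_axioms (gT : finGroupType) (C : Gcategory gT) :
  @is_right_Gfunctor gT (opG C) (nerve_under C) (@nerve_under_eta gT C).
Proof.
split.
- move=> X n s.
  apply: (@undercat_functor_eq _ C X
    (compF (@under_pre C X (gact C 1%g X) (@eqhom (op C) _ _ (gact1_ob X)))
       (compF (@under_map C C (gact C 1%g) X) s)) s
    (fun i => @gact1_ob gT C (projT1 (s i)))).
    move=> i /=; rewrite compmA (functor_hom_eq (gact1 C)) -compmA.
    rewrite -[RHS]compm1; congr (_ \oc _).
    exact: (@eqhom_opK C).
  by move=> i j f /=; exact: (functor_hom_eq (gact1 C)).
- move=> g h X n s; apply: esym.
  apply: (@undercat_functor_eq _ C (gact C g (gact C h X))
    (compF (@under_pre C _ _ (@eqhom (op C) _ _ (gactM_ob g h X)))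
       (compF (@under_map C C (gact C (g * h)%g) X) s))
    (compF (@under_map C C (gact C g) _) (compF (@under_map C C (gact C h) X) s))
    (fun i => @gactM_ob gT C g h (projT1 (s i)))).
    move=> i /=; rewrite compmA (functor_hom_eq (gactM C g h)) -compmA.
    rewrite -[RHS]compm1; congr (_ \oc _).
    exact: (@eqhom_opK C).
  by move=> i j f /=; exact: (functor_hom_eq (gactM C g h)).
- move=> g X Y f n s.
  apply: (@undercat_functor_eq _ C (gact C g Y)
    (compF (@under_map C C (gact C g) Y) (compF (@under_pre C Y X f) s))
    (compF (@under_pre C _ _ (fmor (gact C g) f))
       (compF (@under_map C C (gact C g) X) s)) (fun=> erefl)).
    by move=> i /=; rewrite comp1m fmorM.
  by move=> i j p /=; rewrite comp1m compm1.
Qed.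

Definition nerve_underG (gT : finGroupType) (C : Gcategory gT) :
    right_Gfunctor (opG C) :=
  RightGFunctor (nerve_under_axioms C).

Definition hocolim (gT : finGroupType) (C : Gcategory gT)
    (F : right_Gfunctor C) : GsSet gT :=
  tensorG F (nerve_underG C).

Local Open Scope classical_set_scope.
Local Open Scope ring_scope.

Section Realization.
Variable R : realType.

Definition simplex (n : nat) : set 'rV[R]_n.+1 :=
  [set t | (forall i, 0 <= t ord0 i) /\ \sum_i t ord0 i = 1].

Arguments simplex n _ : clear implicits.

(* The affine map of standard simplices extending a on the vertices. *)
Definition simplex_push m n (a : smor m n) (t : 'rV[R]_m.+1) : 'rV[R]_n.+1 :=
  \row_j \sum_(i | a i == j) t ord0 i.

Lemma simplex_push_subproof m n (a : smor m n) (t : set_type (simplex m)) :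
  simplex_push a (\val t) \in simplex n.
Proof.
case: t => t /=; rewrite inE => -[t0 t1]; apply/mem_set; split=> [j|].
  by rewrite mxE; exact: sumr_ge0.
under eq_bigr do rewrite mxE.
rewrite -t1 (partition_big a predT) //=.
Qed.

Definition simplex_map m n (a : smor m n) (t : set_type (simplex m)) :
    set_type (simplex n) :=
  Sub (simplex_push a (\val t)) (simplex_push_subproof a t).

Definition cell_space (X : sSet) (i : {classic {n : nat & X n}}) :
    topologicalType :=
  set_type (simplex (projT1 i)).

(* The disjoint union, over all n and all x in X_n, of the standard
   n-simplices. *)
Definition cells (X : sSet) : topologicalType :=
  {i : {classic {n : nat & X n}} & cell_space i}.

Definition cell (X : sSet) n (x : X n) (t : set_type (simplex n)) : cells X :=
  existT (@cell_space X) (existT _ n x) t.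

Variant cell_rel (X : sSet) : cells X -> cells X -> Prop :=
  CellRel m n (a : smor m n) (x : X n) (t : set_type (simplex m)) :
    cell_rel (cell (sop a x) t) (cell x (simplex_map a t)).

Definition realization (X : sSet) : topologicalType :=
  quotient_topology (quot (@cell_rel X)).

Definition real_pi (X : sSet) (z : cells X) : realization X :=
  quot_pi (@cell_rel X) z.

Lemma real_ind (X : sSet) (P : realization X -> Prop) :
  (forall z, P (real_pi z)) -> forall p, P p.
Proof. exact: quot_ind. Qed.

Definition cells_map (X Y : sSet) (f : smap X Y) (z : cells X) : cells Y :=
  cell (f _ (projT2 (projT1 z))) (projT2 z).

Definition real_map (X Y : sSet) (f : smap X Y) :
    realization X -> realization Y :=
  quot_lift (fun z => real_pi (cells_map f z)).

Lemma real_mapE (X Y : sSet) (f : smap X Y) z :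
  real_map f (real_pi z) = real_pi (cells_map f z).
Proof.
apply: quot_liftE => _ _ [m n a x t]; apply: quot_eq.
by rewrite /cells_map /= smap_nat; exact: CellRel.
Qed.

Lemma real_map_continuous (X Y : sSet) (f : smap X Y) :
  continuous (real_map f).
Proof.
apply/quotient_continuous.
pose h (i : {classic {n : nat & X n}}) (t : cell_space i) :=
  real_pi (cell (f _ (projT2 i)) t).
have -> : real_map f \o \pi_(realization X)%qT =
    fun z : cells X => h (projT1 z) (projT2 z).
  by apply/funext => z; exact: real_mapE.
apply: (@sigT_continuous _ _ _ h) => i.
move=> t.
apply: (@continuous_comp _ _ _ (cell (f _ (projT2 i))) (@real_pi Y)).
  exact: (@existT_continuous _ (@cell_space Y)
    (existT _ (projT1 i) (f _ (projT2 i)))).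
exact: pi_continuous.
Qed.

End Realization.

Record Gspace (gT : finGroupType) := MkGspace {
  gsp :> topologicalType;
  gsp_act : gT -> gsp -> gsp;
  gsp_act1 : forall x, gsp_act 1%g x = x;
  gsp_actM : forall (g h : gT) x, gsp_act (g * h)%g x = gsp_act g (gsp_act h x);
  gsp_act_continuous : forall g, continuous (gsp_act g) }.

Arguments gsp_act {gT} _ _ _.

Program Definition realizationG (R : realType) (gT : finGroupType)
    (X : GsSet gT) : Gspace gT :=
  @MkGspace gT (realization R X) (fun g => real_map (gs_act X g)) _ _ _.
Next Obligation.
move=> R gT X; apply: real_ind => -[[n x] t].
by rewrite real_mapE /cells_map /= gs_act1.
Qed.
Next Obligation.
move=> R gT X g h; apply: real_ind => -[[n x] t].
by rewrite !real_mapE /cells_map /= gs_actM.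
Qed.
Next Obligation. by move=> R gT X g; exact: real_map_continuous. Qed.

Section GHomotopy.
Variables (R : realType) (gT : finGroupType).

Definition G_map (X Y : Gspace gT) (f : X -> Y) : Prop :=
  continuous f /\ forall g x, f (gsp_act X g x) = gsp_act Y g (f x).

Definition G_homotopic (X Y : Gspace gT) (f f' : X -> Y) : Prop :=
  exists H : X * R -> Y,
    [/\ {within [set: X] `*` `[0, 1], continuous H},
        forall x, H (x, 0) = f x,
        forall x, H (x, 1) = f' x &
        forall g x t, 0 <= t <= 1 ->
          H (gsp_act X g x, t) = gsp_act Y g (H (x, t))].

Definition G_space_equivalent (X Y : Gspace gT) : Prop :=
  exists (f : X -> Y) (f' : Y -> X),
    [/\ G_map f, G_map f', G_homotopic (f' \o f) id & G_homotopic (f \o f') id].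

Definition G_homotopy_equivalent (X Y : GsSet gT) : Prop :=
  G_space_equivalent (realizationG R X) (realizationG R Y).

End GHomotopy.

(* Main.v *)
(** An n-simplex of [hocolim_C S_h*(F)] is a chain [X_0 -> ... -> X_n] in [D], an
    [x] in [F(X_0)_n] and a chain [S X_n -> C_0 -> ... -> C_n] in [C], the map
    [S X_n -> C] of the bar construction being absorbed into the latter.
    Forgetting the chain in [C] is a simplicial G-map [p] to [hocolim_D F].

    A homotopy inverse cannot be simplicial, because the chain in [C] has to
    start at [X_n], but it exists on realizations.  View a point [t] of the
    n-simplex as a step function on [[0, 1]], and two copies of [t] as a step
    function on [[0, 2]] with values in the chain
    [S X_0 -> ... -> S X_n -> C_0 -> ... -> C_n].  For [1/2 <= l <= 1] restrict the
    first function to [[0, l]] for the part in [D] and the second one to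
    [[l, 2l]] for the part in [C].  This is a homotopy of self-maps of the
    realization: it is the identity at [l = 1], and at [l = 1/2] the second
    restriction only takes values [S X_i], so that the map factors through [p];
    the factorization is the homotopy inverse.  All the formulas are natural in
    the simplex, hence compatible with the action of G. *)

From Pilot Require Import Defs.
From mathcomp Require Import all_boot all_order all_algebra all_fingroup.
From mathcomp Require Import all_classical all_reals topology normedtype.
From mathcomp Require Import zify lra.
Import Order.TTheory GRing.Theory Num.Theory.
Import numFieldNormedType.Exports.
(* Again, as the group library also defines [gact] and [hom]. *)
Import Pilot.Defs.

Set Implicit Arguments.
Unset Strict Implicit.
Unset Printing Implicit Defensive.

Local Obligation Tactic := idtac.
Local Open Scope classical_set_scope.
Local Open Scope ring_scope.

(** * Monotone maps between finite ordinals *)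

Lemma smor_eq m n (a b : smor m n) : a =1 b -> a = b.
Proof.
case: a b => [a am] [b bm] /= ab.
have {ab} ab : a = b by apply: funext.
by case: _ / ab in bm *; rewrite (Prop_irrelevance am bm).
Qed.

(** Initial segments pull back to initial segments. Hence the partial sums of [simplex_push a t] are
    partial sums of [t], and identities between points of simplices can be checked on partial
    sums. *)
Lemma smor_downset m n (a : smor m n) k :
  exists2 l, (l <= m.+1)%N & forall i, (a i < k)%N = (i < l)%N.
Proof.
pose P l := [forall i : 'I_m.+1, (l <= i)%N ==> (k <= a i)%N].
have Pm : P m.+1 by apply/forallP => i; rewrite leqNgt ltn_ord.
have exP : exists l, P l by exists m.+1.
case: (ex_minnP exP) => l /forallP Pl lmin; exists l; first exact: lmin.
move=> i; apply/idP/idP => [|il].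
  by apply: contraTT; rewrite -!leqNgt => /(implyP (Pl i)).
rewrite ltnNge; apply/negP => kai.
suff : (l <= i)%N by rewrite leqNgt il.
apply: lmin; apply/forallP => j; apply/implyP => ij.
exact: leq_trans kai (smor_homo a ij).
Qed.

(** * Points of a simplex as step functions *)

Section PartialSums.
Variable R : realType.
Implicit Types (s : R).

Definition psum n (t : 'rV[R]_n.+1) (k : nat) : R :=
  \sum_(i < n.+1 | (i < k)%N) t ord0 i.

Lemma psum0 n (t : 'rV[R]_n.+1) : psum t 0 = 0.
Proof. by rewrite /psum big_pred0. Qed.

Lemma psumS n (t : 'rV[R]_n.+1) (i : 'I_n.+1) :
  psum t i.+1 = psum t i + t ord0 i.
Proof.
rewrite /psum (bigD1 i) //= addrC; congr (_ + _); apply: eq_bigl => j.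
by rewrite ltnS [in RHS]ltn_neqAle andbC.
Qed.

Lemma psum_all n (t : 'rV[R]_n.+1) k :
  (n < k)%N -> psum t k = \sum_i t ord0 i.
Proof.
by move=> nk; apply: eq_bigl => i; rewrite (leq_trans (ltn_ord i)).
Qed.

Lemma psum_inj n (t t' : 'rV[R]_n.+1) : psum t =1 psum t' -> t = t'.
Proof.
move=> tt'; apply/rowP => i; have := tt' i.+1.
by rewrite !psumS tt' => /addrI.
Qed.

Lemma psumD n (t t' : 'rV[R]_n.+1) k : psum (t + t') k = psum t k + psum t' k.
Proof. by rewrite /psum -big_split; apply: eq_bigr => i _; rewrite mxE. Qed.

Lemma psum_push m n (a : smor m n) (t : 'rV[R]_m.+1) k l :
  (forall i, (a i < k)%N = (i < l)%N) -> psum (simplex_push a t) k = psum t l.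
Proof.
move=> akl; rewrite /psum [RHS](partition_big a (fun j => (j < k)%N)) /=.
  apply: eq_bigr => j jk; rewrite mxE; apply: eq_bigl => i.
  by rewrite -akl; case: eqP => [->|]; rewrite ?jk ?andbF.
by move=> i; rewrite akl.
Qed.

Lemma simplex_push_comp l m n (b : smor m n) (a : smor l m) (t : 'rV[R]_l.+1) :
  simplex_push (smor_comp b a) t = simplex_push b (simplex_push a t).
Proof.
apply: psum_inj => k; have [k' _ bk] := smor_downset b k.
have [k'' _ ak] := smor_downset a k'.
rewrite (psum_push _ bk) (psum_push _ ak) (@psum_push _ _ _ _ _ k'') // => i.
by rewrite /= bk ak.
Qed.

Lemma simplex_push_id n (t : 'rV[R]_n.+1) : simplex_push (smor_id n) t = t.
Proof. by apply: psum_inj => k; apply: psum_push. Qed.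

Lemma psum_le n (t : 'rV[R]_n.+1) k l : (forall i, 0 <= t ord0 i) ->
  (k <= l)%N -> psum t k <= psum t l.
Proof.
move=> t0 kl; rewrite /psum big_mkcond [leRHS]big_mkcond /=.
apply: ler_sum => i _; case: ifP => [ik|_]; last by case: ifP.
by rewrite (leq_trans ik kl).
Qed.

Lemma psum_le1 n (t : 'rV[R]_n.+1) k : simplex t -> psum t k <= 1.
Proof.
move=> [t0 t1]; have [kn|nk] := leqP k n.+1.
  by rewrite -t1 -(psum_all _ (ltnSn n)); exact: psum_le.
by rewrite psum_all ?t1 // ltnW.
Qed.

Lemma psum_ge0 n (t : 'rV[R]_n.+1) k : simplex t -> 0 <= psum t k.
Proof. by move=> [t0 _]; rewrite -(psum0 t); exact: psum_le. Qed.

(* The value at [s] of the step function on [0, 1[ taking the value [i] on an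
   interval of length [t i]; at [s >= 1] it takes its last value. *)
Definition step n (t : 'rV[R]_n.+1) s : 'I_n.+1 :=
  [arg max_(i > ord0 | ((psum t i <= s) && (psum t i < 1))%R) i]%N.

(** Partial sums are nondecreasing, so the indices over which [step] maximizes form an initial
    segment. The strict bound by 1 keeps the value in the support of [t], also for [s >= 1]. *)
Lemma step_ge n (t : 'rV[R]_n.+1) s i : simplex t -> 0 <= s -> (i <= n)%N ->
  (i <= step t s)%N = (psum t i <= s) && (psum t i < 1).
Proof.
move=> st s0; rewrite -ltnS => ilt; rewrite /step; case: arg_maxnP => /=.
  by rewrite psum0 s0 ltr01.
move=> j /andP[js j1] jmax; apply/idP/idP => [ij|]; last exact: (jmax (Ordinal ilt)).
have ij' : psum t i <= psum t j by apply: psum_le => //; case: st.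
by rewrite (le_trans ij' js) (le_lt_trans ij' j1).
Qed.

Lemma step_supp n (t : 'rV[R]_n.+1) s : simplex t -> 0 <= s ->
  t ord0 (step t s) != 0.
Proof.
move=> st s0; apply/eqP => t0; set i := step t s in t0 *.
have iS : psum t i.+1 = psum t i by rewrite psumS t0 addr0.
have := step_ge st s0 (leq_ord i); rewrite leqnn -iS => /esym/andP[i0 i1].
have [iN|] := leqP i.+1 n.
  by have := step_ge st s0 iN; rewrite i0 i1 ltnn.
by rewrite ltnS => ni; move: i1; rewrite psum_all //; case: st => _ ->; rewrite ltxx.
Qed.

(** Both sides have the same lower bounds [i]: by [step_ge] these are governed by the partial sum of
    [t] over the initial segment that [a] sends below [i]. *)
Lemma step_push m n (a : smor m n) (t : 'rV[R]_m.+1) s :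
  simplex t -> 0 <= s -> step (simplex_push a t) s = a (step t s).
Proof.
move=> st s0.
have sat : simplex (simplex_push a t).
  have := simplex_push_subproof a (Sub t (mem_set st) : set_type (@simplex R m)).
  by rewrite inE.
have key i : (i <= n)%N ->
    (i <= step (simplex_push a t) s)%N = (i <= a (step t s))%N.
  move=> ilen; rewrite (step_ge sat s0 ilen) [RHS]leqNgt.
  have [k km ak] := smor_downset a i; rewrite ak -leqNgt (psum_push _ ak).
  have [kM|] := leqP k m; first by rewrite (step_ge st s0 kM).
  move=> mk; rewrite psum_all //; have [_ ->] := st; rewrite ltxx andbF.
  by apply/esym/negbTE; rewrite -ltnNge (leq_trans (ltn_ord _)).
apply/val_inj/eqP => /=; rewrite eqn_leq.
by rewrite -key ?leq_ord // leqnn key ?leq_ord // leqnn.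
Qed.

Lemma step_le n (t : 'rV[R]_n.+1) s s' : simplex t -> 0 <= s -> s <= s' ->
  (step t s <= step t s')%N.
Proof.
move=> st s0 ss'; have s0' := le_trans s0 ss'.
rewrite (step_ge st s0' (leq_ord _)).
have := step_ge st s0 (leq_ord (step t s)); rewrite leqnn => /esym/andP[h ->].
by rewrite (le_trans h ss').
Qed.

(** There are [N.+1] gaps, hence a point of the [N]-simplex. Grid points may coincide, so that a
    common refinement has a fixed number of points and varies continuously with the points that it
    refines. *)
Definition grid N (r : nat -> R) :=
  [/\ r 0%N = 0, r N.+1 = 1 & {homo r : i j / (i <= j)%N >-> i <= j}].

Lemma grid_ge0 N r j : grid N r -> 0 <= r j.
Proof. by move=> [r0 _ rh]; rewrite -r0; exact: rh. Qed.

Definition gaps N (r : nat -> R) : 'rV[R]_N.+1 := \row_j (r j.+1 - r j).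

Lemma psum_gaps N r k : grid N r -> (k <= N.+1)%N -> psum (gaps N r) k = r k.
Proof.
move=> [r0 _ _]; elim: k => [|k IH] kN; first by rewrite psum0 r0.
have -> := psumS (gaps N r) (Ordinal kN).
by rewrite (IH (ltnW kN)) mxE addrC subrK.
Qed.

Lemma gaps_simplex N r : grid N r -> simplex (gaps N r).
Proof.
move=> gr; split=> [i|]; first by rewrite mxE subr_ge0; case: gr => _ _; apply.
by rewrite -(psum_all _ (ltnSn N)) (psum_gaps gr) //; case: gr.
Qed.

Definition step_smor n (t : 'rV[R]_n.+1) N (r : nat -> R) (st : simplex t)
    (gr : grid N r) : smor N n :=
  @SMor N n (fun j => step t (r j)) (fun i j ij =>
    step_le st (grid_ge0 i gr) (let: And3 _ _ rh := gr in rh _ _ ij)).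

(** All jumps of the step function of [t] lie on the grid, so it is constant on each gap, and the
    gaps where it takes the value [i] have total length [t ord0 i]. *)
Lemma push_gaps n (t : 'rV[R]_n.+1) N r (st : simplex t) (gr : grid N r) :
  (forall i, (i <= n)%N -> psum t i < 1 ->
     exists2 j, (j <= N)%N & r j = psum t i) ->
  simplex_push (step_smor st gr) (gaps N r) = t.
Proof.
move=> tr; apply: psum_inj => k.
have [l lN rl] := smor_downset (step_smor st gr) k.
rewrite (psum_push _ rl) psum_gaps //; have [r0 r1 rh] := gr.
have [kn|nk] := leqP k n; last first.
  rewrite psum_all // (proj2 st).
  have := rl ord_max; rewrite (leq_trans (ltn_ord _)) //= => /esym Nl.
  by rewrite (_ : l = N.+1) //; apply/eqP; rewrite eqn_leq lN Nl.
have {}rl j : (j <= N)%N -> (j < l)%N = ~~ ((psum t k <= r j) && (psum t k < 1)).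
  rewrite -ltnS => jN; rewrite -(rl (Ordinal jN)) /= -(step_ge st) ?ltnNge //.
  exact: (grid_ge0 j gr).
have [tk1|] := ltP (psum t k) 1; last first.
  move=> tk1; have := rl N (leqnn _); rewrite [_ < 1]ltNge tk1 andbF => /= Nl.
  rewrite (_ : l = N.+1) ?r1; last by apply/eqP; rewrite eqn_leq lN.
  by apply/eqP; rewrite eq_le tk1 psum_le1.
have [j jN rj] := tr k kn tk1.
have lj : (l <= j)%N by rewrite leqNgt rl // -rj lexx rj tk1.
apply/eqP; rewrite eq_le; apply/andP; split; first by rewrite -rj; exact: rh.
have := rl l (leq_trans lj jN); rewrite ltnn tk1 andbT => /esym/negbT.
by rewrite negbK.
Qed.

(* Insertion sort by [min] and [max], so that the entries of the sorted list
   visibly are continuous functions of the unsorted ones. *)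
Fixpoint bubble (x : R) (l : seq R) : seq R :=
  if l is y :: l' then Num.min x y :: bubble (Num.max x y) l' else [:: x].

Definition bsort : seq R -> seq R := foldr bubble [::].

Lemma perm_bubble x l : perm_eq (bubble x l) (x :: l).
Proof.
elim: l x => [|y l IH] x //=; rewrite minElt maxElt; case: ltP => _.
  by rewrite perm_cons.
apply: (@perm_trans _ (y :: x :: l)); first by rewrite perm_cons.
by rewrite (perm_catCA [:: y] [:: x] l).
Qed.

Lemma bubble_path z x l : z <= x -> path <=%R z l -> path <=%R z (bubble x l).
Proof.
elim: l z x => [|y l IH] z x /=; first by rewrite andbT.
move=> zx /andP[zy yl]; rewrite le_min zx zy /=; apply: IH.
  by rewrite ge_min le_max lexx.
case: l yl => //= w l /andP[yw ->]; rewrite andbT.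
by rewrite ge_min yw orbT.
Qed.

Lemma perm_bsort l : perm_eq (bsort l) l.
Proof.
elim: l => //= x l IH; apply: (perm_trans (perm_bubble _ _)).
by rewrite perm_cons.
Qed.

Lemma bsort_path z l : {in l, forall x, z <= x} -> path <=%R z (bsort l).
Proof.
elim: l => //= x l IH zl; apply: bubble_path; first by apply: zl; rewrite mem_head.
by apply: IH => y yl; apply: zl; rewrite inE yl orbT.
Qed.

(** The default 1 of [nth] supplies the right end of the grid and all later entries. *)
Definition grid_of (l : seq R) (j : nat) : R := nth 1 (0 :: bsort l) j.

Lemma grid_of_grid l : {in l, forall x, 0 <= x <= 1} ->
  grid (size l) (grid_of l).
Proof.
move=> l01; have sl : size (bsort l) = size l := perm_size (perm_bsort l).
split=> [//||i j ij]; first by rewrite /grid_of nth_default //= sl.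
have [jl|lj] := leqP (size (bsort l)).+1 j.
  rewrite {2}/grid_of nth_default // /grid_of; case: i {ij} => [|i] //=.
  have [il|li] := ltnP i (size (bsort l)); last by rewrite nth_default.
  have : nth 1 (bsort l) i \in l by rewrite -(perm_mem (perm_bsort l)) mem_nth.
  by move=> /l01/andP[].
have : sorted <=%R (0 :: bsort l).
  by apply: bsort_path => x /l01/andP[].
move=> /(sorted_leq_nth le_trans le_refl 1); apply=> //.
by rewrite inE /= (leq_ltn_trans ij lj).
Qed.

Lemma grid_of_mem l x : x \in l -> exists2 j, (j <= size l)%N & grid_of l j = x.
Proof.
move=> xl; exists (index x (bsort l)).+1 => /=.
  by rewrite -(perm_size (perm_bsort l)) index_mem (perm_mem (perm_bsort l)).
by rewrite /grid_of /= nth_index // (perm_mem (perm_bsort l)).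
Qed.

(** For a point of the simplex the sum up to [n.+1] is 1; it is omitted because every grid ends
    there. *)
Definition breaks n (t : 'rV[R]_n.+1) : seq R := [seq psum t i | i <- iota 0 n.+1].

Lemma breaks01 n (t : 'rV[R]_n.+1) : simplex t ->
  {in breaks t, forall x, 0 <= x <= 1}.
Proof. by move=> st _ /mapP[i _ ->]; rewrite psum_ge0 // psum_le1. Qed.

Lemma mem_breaks n (t : 'rV[R]_n.+1) i : (i <= n)%N -> psum t i \in breaks t.
Proof. by move=> lein; apply: map_f; rewrite mem_iota. Qed.

End PartialSums.

(** * Continuity on products of simplices *)

Section Topo.
Variables (R : realType) (T : topologicalType).

Lemma row_continuous n (u : T -> 'rV[R]_n) :
  (forall i, continuous (fun k => u k ord0 i)) -> continuous u.
Proof.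
move=> cu k U [P PU sPU].
apply: (filterS (P := [set l | forall i, P ord0 i (u l ord0 i)])).
  by move=> l Pl; apply: sPU => i j; rewrite !ord1.
apply: filter_forall => i; exact: cu.
Qed.

Lemma min_fun_continuous (f g : T -> R) : continuous f -> continuous g ->
  continuous (fun k => Num.min (f k) (g k)).
Proof. by move=> cf cg k; apply: continuous_min; [exact: cf|exact: cg]. Qed.

Lemma max_fun_continuous (f g : T -> R) : continuous f -> continuous g ->
  continuous (fun k => Num.max (f k) (g k)).
Proof. by move=> cf cg k; apply: continuous_max; [exact: cf|exact: cg]. Qed.

Lemma sub_fun_continuous (f g : T -> R) : continuous f -> continuous g ->
  continuous (fun k => f k - g k).
Proof. by move=> cf cg k; apply: continuousB; [exact: cf|exact: cg]. Qed.

Lemma add_fun_continuous (f g : T -> R) : continuous f -> continuous g ->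
  continuous (fun k => f k + g k).
Proof. by move=> cf cg k; apply: continuousD; [exact: cf|exact: cg]. Qed.

Lemma mul_fun_continuous (f g : T -> R) : continuous f -> continuous g ->
  continuous (fun k => f k * g k).
Proof. by move=> cf cg k; apply: continuousM; [exact: cf|exact: cg]. Qed.

Lemma inv_fun_continuous (f : T -> R) : continuous f -> (forall k, f k != 0) ->
  continuous (fun k => (f k)^-1).
Proof. by move=> cf f0 k; apply: (@cvgV R _ (nbhs k) _ f _ (f0 k)); exact: cf. Qed.

Lemma sum_fun_continuous (I : finType) (P : pred I) (f : I -> T -> R) :
  (forall i, continuous (f i)) -> continuous (fun k => \sum_(i | P i) f i k).
Proof.
move=> cf; have := @continuous_big R^o I +%R 0 P (@add_continuous R^o) T.
by move=> /(_ _ f (fun i _ => cf i)).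
Qed.

Lemma bubble_continuous n (g : T -> R) (l : T -> seq R) j :
  continuous g -> (forall k, size (l k) = n) ->
  (forall i, continuous (fun k => nth 1 (l k) i)) ->
  continuous (fun k => nth 1 (bubble (g k) (l k)) j).
Proof.
elim: n g l j => [|n IH] g l j cg sl cl.
  have l0 k : l k = [::] by apply: size0nil.
  under [X in continuous X]eq_fun do rewrite l0.
  by case: j => [|j] //=; under [X in continuous X]eq_fun do rewrite nth_nil;
    move=> k; exact: cvg_cst.
have lE k : l k = nth 1 (l k) 0 :: behead (l k).
  by case: (l k) (sl k).
under [X in continuous X]eq_fun do rewrite lE.
case: j => [|j] /=; first by apply: min_fun_continuous => //; exact: cl.
apply: (IH (fun k => Num.max (g k) (nth 1 (l k) 0))).
- by apply: max_fun_continuous => //; exact: cl.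
- by move=> k; rewrite size_behead sl.
- by move=> i; under [X in continuous X]eq_fun do rewrite nth_behead; exact: cl.
Qed.

Lemma bsort_continuous n (l : T -> seq R) j : (forall k, size (l k) = n) ->
  (forall i, continuous (fun k => nth 1 (l k) i)) ->
  continuous (fun k => nth 1 (bsort (l k)) j).
Proof.
elim: n l j => [|n IH] l j sl cl.
  have l0 k : l k = [::] by apply: size0nil.
  by under [X in continuous X]eq_fun do rewrite l0 nth_nil; move=> k; exact: cvg_cst.
have lE k : l k = nth 1 (l k) 0 :: behead (l k).
  by case: (l k) (sl k).
under [X in continuous X]eq_fun do rewrite lE /=.
have sb k : size (behead (l k)) = n by rewrite size_behead sl.
apply: (@bubble_continuous n); first exact: cl.
  by move=> k; rewrite (perm_size (perm_bsort _)).
move=> i; apply: IH => // {}i.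
by under [X in continuous X]eq_fun do rewrite nth_behead; exact: cl.
Qed.

Lemma psum_continuous n (u : T -> 'rV[R]_n.+1) i :
  (forall i, continuous (fun k => u k ord0 i)) ->
  continuous (fun k => psum (u k) i).
Proof. by move=> cu; apply: sum_fun_continuous. Qed.

Lemma eq_closed (f g : T -> R) : continuous f -> continuous g ->
  closed [set k | f k = g k].
Proof.
move=> cf cg; rewrite (_ : mkset _ = (fun k => f k - g k) @^-1` [set x | x = 0]).
  have /continuous_closedP := sub_fun_continuous cf cg; apply; exact: closed_eq.
by apply/seteqP; split=> k /= => [->|/eqP]; rewrite ?subrr // subr_eq0 => /eqP.
Qed.

Lemma row_eq_closed n (f g : T -> 'rV[R]_n) :
  (forall i, continuous (fun k => f k ord0 i)) ->
  (forall i, continuous (fun k => g k ord0 i)) ->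
  closed [set k | f k = g k].
Proof.
move=> cf cg; rewrite (_ : mkset _ = \bigcap_i [set k | f k ord0 i = g k ord0 i]).
  by apply: closed_bigI => i _; exact: eq_closed.
apply/seteqP; split=> k /= fg; first by move=> i _ /=; rewrite fg.
by apply/rowP => i; exact: fg.
Qed.

End Topo.

(** * Related pairs of simplices, and points of realizations obtained from them *)

Section Pairs.
Variables (p q : nat) (L : 'I_p.+1 -> 'I_q.+1 -> bool).

(** The indices [i] and [j] are independent: this is the union in the product of the [p]-simplex and
    the [q]-simplex of the products of faces spanned by vertex sets [A] and [B] with [A x B]
    contained in [L]. *)
Definition pairs_simp N : Type :=
  {ab : smor N p * smor N q | forall i j, L (ab.1 i) (ab.2 j)}.

Definition pairs_sop M N (d : smor M N) (ab : pairs_simp N) : pairs_simp M :=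
  exist (fun ab : smor M p * smor M q => forall i j, L (ab.1 i) (ab.2 j))
    (smor_comp (proj1_sig ab).1 d, smor_comp (proj1_sig ab).2 d)
    (fun i j => proj2_sig ab (d i) (d j)).

Lemma pairs_eq N (k l : pairs_simp N) : (proj1_sig k).1 =1 (proj1_sig l).1 ->
  (proj1_sig k).2 =1 (proj1_sig l).2 -> k = l.
Proof.
case: k l => [[a b] /= kL] [[a' b'] /= lL] /smor_eq aa' /smor_eq bb'.
by apply: sig_eq; rewrite /= aa' bb'.
Qed.

Definition pairs : sSet :=
  @SSet pairs_simp pairs_sop
    (fun N k => @pairs_eq N (pairs_sop (smor_id N) k) k
      (fun=> erefl) (fun=> erefl))
    (fun l m n b a k => @pairs_eq l (pairs_sop (smor_comp b a) k)
      (pairs_sop a (pairs_sop b k)) (fun=> erefl) (fun=> erefl)).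

End Pairs.

Section RealPoints.
Variables (R : realType) (X : sSet).

Definition real_point n (x : X n) (t : set_type (@simplex R n)) : realization R X :=
  real_pi (cell x t).

Lemma point_push m n (a : smor m n) (x : X n) t t' :
  simplex_push a (\val t) = \val t' -> real_point (sop a x) t = real_point x t'.
Proof.
move=> tt'; rewrite (_ : t' = simplex_map a t); last exact/val_inj.
by apply: quot_eq; exact: CellRel.
Qed.

Lemma point_continuous n (x : X n) : continuous (real_point x).
Proof.
move=> t; apply: (@continuous_comp _ _ _ (cell x) (@real_pi R X)).
  exact: (@existT_continuous _ (@cell_space R X) (existT _ n x)).
exact: pi_continuous.
Qed.

Definition to_simplex n (t : 'rV[R]_n.+1) (st : simplex t) : set_type (@simplex R n) :=
  Sub t (mem_set st).

Lemma to_simplex_continuous (T : topologicalType) n (u : T -> 'rV[R]_n.+1)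
    (su : forall k, simplex (u k)) :
  (forall i, continuous (fun k => u k ord0 i)) ->
  continuous (fun k => to_simplex (su k)).
Proof. by move=> cu; apply: continuous_comp_initial; exact: row_continuous. Qed.

Lemma simplexP n (t : set_type (@simplex R n)) : simplex (\val t).
Proof. by case: t => t /= /set_mem. Qed.

Section PairsPoints.
Variables (p q : nat) (L : 'I_p.+1 -> 'I_q.+1 -> bool).
Variable f : smap (pairs L) X.

Lemma step_breaks n (t : 'rV[R]_n.+1) N l (st : simplex t) (gl : grid N (grid_of l)) :
  size l = N -> {subset breaks t <= l} ->
  simplex_push (step_smor st gl) (gaps N (grid_of l)) = t.
Proof.
move=> lN tl; apply: push_gaps => i lein _; rewrite -lN; apply: grid_of_mem.
exact/tl/mem_breaks.
Qed.

(* Both points are rewritten over the common refinement of the subdivisions of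
   the unit interval given by [w] and [w']. *)
Lemma pairs_point_eq M N (k : pairs L M) (l : pairs L N) w w' :
  simplex_push (proj1_sig k).1 (\val w) = simplex_push (proj1_sig l).1 (\val w') ->
  simplex_push (proj1_sig k).2 (\val w) = simplex_push (proj1_sig l).2 (\val w') ->
  real_point (f _ k) w = real_point (f _ l) w'.
Proof.
move=> e1 e2; have [sw sw'] := (simplexP w, simplexP w').
set s := breaks (\val w) ++ breaks (\val w').
have gs : grid (size s) (grid_of s).
  by apply: grid_of_grid => x; rewrite mem_cat => /orP[]; exact: breaks01.
have <- : real_point (sop (step_smor sw gs) (f _ k))
    (to_simplex (gaps_simplex gs)) = real_point (f _ k) w.
  apply: point_push; apply: step_breaks => // x xw.
  by rewrite mem_cat xw.
have <- : real_point (sop (step_smor sw' gs) (f _ l))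
    (to_simplex (gaps_simplex gs)) = real_point (f _ l) w'.
  apply: point_push; apply: step_breaks => // x xw.
  by rewrite mem_cat xw orbT.
rewrite -!smap_nat; congr (real_point (f _ _) _); apply: pairs_eq => j /=.
  by rewrite -!step_push ?e1 //; exact: grid_ge0 gs.
by rewrite -!step_push ?e2 //; exact: grid_ge0 gs.
Qed.

Lemma breaks2_grid (u : 'rV[R]_p.+1) (v : 'rV[R]_q.+1) : simplex u -> simplex v ->
  grid (p.+1 + q.+1) (grid_of (breaks u ++ breaks v)).
Proof.
move=> su sv; have := @grid_of_grid R (breaks u ++ breaks v).
rewrite size_cat !size_map !size_iota; apply=> x.
by rewrite mem_cat => /orP[]; exact: breaks01.
Qed.

(** The two step functions are sampled on the common grid. Their values lie in the supports of [u]
    and [v], which gives both the relation [L] and the last clause; the latter later confines the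
    part in [C] at parameter 0 to the first copy. *)
Lemma pairs_lift (u : 'rV[R]_p.+1) (v : 'rV[R]_q.+1) (su : simplex u)
    (sv : simplex v) :
  (forall i j, u ord0 i != 0 -> v ord0 j != 0 -> L i j) ->
  exists2 k : pairs L (p.+1 + q.+1),
    simplex_push (proj1_sig k).1 (gaps _ (grid_of (breaks u ++ breaks v))) = u /\
    simplex_push (proj1_sig k).2 (gaps _ (grid_of (breaks u ++ breaks v))) = v &
    forall j, v ord0 ((proj1_sig k).2 j) != 0.
Proof.
move=> uvL; have gr := breaks2_grid su sv; have r0 := grid_ge0 _ gr.
have kL i j : L (step_smor su gr i) (step_smor sv gr j).
  by apply: uvL; exact: step_supp.
exists (exist (fun ab : smor _ p * smor _ q => forall i j, L (ab.1 i) (ab.2 j))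
   (step_smor su gr, step_smor sv gr) kL) => [|j]; last exact: step_supp.
by split; apply: step_breaks => [|x xuv];
  rewrite ?mem_cat ?xuv ?orbT // size_cat !size_map !size_iota.
Qed.

(* The domain is covered by finitely many closed pieces, one for each simplex of
   [pairs L], on which [h] is the composite of the characteristic map of this
   simplex with the gaps of the common refinement of [u] and [v]. *)
Lemma pairs_continuous (T : topologicalType) (u : T -> 'rV[R]_p.+1)
    (v : T -> 'rV[R]_q.+1) (h : T -> realization R X) :
  (forall k, simplex (u k)) -> (forall k, simplex (v k)) ->
  (forall i, continuous (fun k => u k ord0 i)) ->
  (forall i, continuous (fun k => v k ord0 i)) ->
  (forall k i j, u k ord0 i != 0 -> v k ord0 j != 0 -> L i j) ->
  (forall k N (ab : pairs L N) w, simplex_push (proj1_sig ab).1 (\val w) = u k ->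
     simplex_push (proj1_sig ab).2 (\val w) = v k -> h k = real_point (f _ ab) w) ->
  continuous h.
Proof.
move=> su sv cu cv uvL hE; apply/continuous_closedP => A cA.
set N := (p.+1 + q.+1)%N.
pose l k := breaks (u k) ++ breaks (v k); pose w k := gaps N (grid_of (l k)).
have sw k : simplex (w k) by exact: gaps_simplex (breaks2_grid (su k) (sv k)).
have cw i : continuous (fun k => w k ord0 i).
  have cl j : continuous (fun k => grid_of (l k) j).
    case: j => [|j]; first by move=> k; exact: cvg_cst.
    apply: (@bsort_continuous _ _ N) => [k|{}j].
      by rewrite size_cat !size_map !size_iota.
    have [jp|pj] := ltnP j p.+1.
      under [X in continuous X]eq_fun do
        rewrite nth_cat size_map size_iota jp (nth_map 0%N) ?size_iota //.
      exact: psum_continuous.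
    under [X in continuous X]eq_fun do
      rewrite nth_cat size_map size_iota ltnNge pj /=.
    have [qj|jq] := leqP q.+1 (j - p.+1).
      under [X in continuous X]eq_fun do rewrite nth_default ?size_map ?size_iota //.
      by move=> k; exact: cvg_cst.
    under [X in continuous X]eq_fun do rewrite (nth_map 0%N) ?size_iota //.
    exact: psum_continuous.
  under [X in continuous X]eq_fun do rewrite mxE.
  by apply: sub_fun_continuous.
have cpush n (a : smor N n) i : continuous (fun k => simplex_push a (w k) ord0 i).
  under [X in continuous X]eq_fun do rewrite mxE.
  exact: sum_fun_continuous.
(* The pieces are indexed by pairs of finite functions so that the union is visibly finite; such a
   pair comes from at most one simplex of [pairs L]. *)
pose E (ab : {ffun 'I_N.+1 -> 'I_p.+1} * {ffun 'I_N.+1 -> 'I_q.+1}) :=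
  [set k | exists c : pairs L N, [/\ (proj1_sig c).1 =1 ab.1,
     (proj1_sig c).2 =1 ab.2, simplex_push (proj1_sig c).1 (w k) = u k,
     simplex_push (proj1_sig c).2 (w k) = v k &
     A (real_point (f _ c) (to_simplex (sw k)))]].
have -> : h @^-1` A = \bigcup_(ab in setT) E ab.
  apply/seteqP; split=> [k /= Ahk|k /= [ab _ [c [_ _ cu' cv' Ac]]]]; last first.
    by rewrite (hE k N c (to_simplex (sw k))).
  have [c [cu' cv'] _] := pairs_lift (su k) (sv k) (uvL k).
  exists (finfun (proj1_sig c).1, finfun (proj1_sig c).2) => //.
  exists c; split=> //; first by move=> i; rewrite ffunE.
    by move=> i; rewrite ffunE.
  by rewrite -(hE k N c (to_simplex (sw k))).
apply: closed_bigcup; first exact: finite_finset.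
move=> ab _.
have [[c [c1 c2]]|noc] := pselect (exists c : pairs L N,
    (proj1_sig c).1 =1 ab.1 /\ (proj1_sig c).2 =1 ab.2); last first.
  rewrite (_ : E ab = set0); first exact: closed0.
  by apply/seteqP; split=> k //= [c [c1 c2 _ _ _]]; apply: noc; exists c.
rewrite (_ : E ab = [set k | simplex_push (proj1_sig c).1 (w k) = u k] `&`
    [set k | simplex_push (proj1_sig c).2 (w k) = v k] `&`
    (fun k => real_point (f _ c) (to_simplex (sw k))) @^-1` A); last first.
  apply/seteqP; split=> k /= => [[c' [c1' c2' ? ? ?]]|[[? ?] ?]]; last by exists c.
  rewrite (_ : c = c') //; apply: pairs_eq => i; first by rewrite c1 c1'.
  by rewrite c2 c2'.
apply: closedI; first by apply: closedI; apply: row_eq_closed.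
have /continuous_closedP :
    continuous (fun k => real_point (f _ c) (to_simplex (sw k))).
  move=> k; apply: (@continuous_comp _ _ _ (fun k => to_simplex (sw k))
    (real_point (f _ c))).
    exact: to_simplex_continuous.
  exact: point_continuous.
exact.
Qed.

End PairsPoints.
End RealPoints.

(** * The homotopy on a simplex *)

Section Doubling.

(* The vertices of the (2n+1)-simplex are those of two consecutive copies of the
   n-simplex. *)
Definition dinl n : smor n (n + n.+1) :=
  @SMor n (n + n.+1) (@lshift n.+1 n.+1) (fun _ _ => id).

Lemma dinr_homo n (i j : 'I_n.+1) : (i <= j)%N ->
  (rshift n.+1 i <= rshift n.+1 j)%N.
Proof. by move=> ij; rewrite /= leq_add2l. Qed.

Definition dinr n : smor n (n + n.+1) :=
  @SMor n (n + n.+1) (@rshift n.+1 n.+1) (@dinr_homo n).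

Definition dsplit n (j : 'I_(n + n.+1).+1) : 'I_n.+1 + 'I_n.+1 :=
  fintype.split (j : 'I_(n.+1 + n.+1)).

Definition dsum m n (a : smor m n) (j : 'I_m.+1 + 'I_m.+1) : 'I_n.+1 + 'I_n.+1 :=
  match j with inl i => inl (a i) | inr i => inr (a i) end.

(** This is the join of [a] with itself. *)
Definition dmap_fun m n (a : smor m n) (j : 'I_(m + m.+1).+1) : 'I_(n + n.+1).+1 :=
  unsplit (dsum a (dsplit j)).

Lemma dsplitP n (j : 'I_(n + n.+1).+1) :
  (exists2 i : 'I_n.+1, j = dinl n i & dsplit j = inl i) \/
  (exists2 i : 'I_n.+1, j = dinr n i & dsplit j = inr i).
Proof.
rewrite /dsplit; case: (splitP (j : 'I_(n.+1 + n.+1))) => i ij; [left|right];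
  by exists i => //; apply: val_inj.
Qed.

Lemma dsplit_inl n i : dsplit (dinl n i) = inl i.
Proof. exact: (unsplitK (inl i)). Qed.

Lemma dsplit_inr n i : dsplit (dinr n i) = inr i.
Proof. exact: (unsplitK (inr i)). Qed.

Lemma dsplit_map m n (a : smor m n) j : dsplit (dmap_fun a j) = dsum a (dsplit j).
Proof. exact: unsplitK. Qed.

Lemma dmap_homo m n (a : smor m n) (i j : 'I_(m + m.+1).+1) : (i <= j)%N ->
  (dmap_fun a i <= dmap_fun a j)%N.
Proof.
rewrite /dmap_fun.
have [[i' -> ->]|[i' -> ->]] := dsplitP i;
  have [[j' -> ->]|[j' -> ->]] := dsplitP j; rewrite /= => ij.
- exact: smor_homo.
- by rewrite (leq_trans (ltnW (ltn_ord (a i')))) // leq_addr.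
- by move: ij; rewrite leqNgt (leq_trans (ltn_ord j')) // leq_addr.
- by rewrite leq_add2l smor_homo // -(leq_add2l m.+1).
Qed.

Definition dmap m n (a : smor m n) : smor (m + m.+1) (n + n.+1) :=
  @SMor _ _ (dmap_fun a) (@dmap_homo m n a).

Lemma dmap_ge m n (a : smor m n) (i : 'I_m.+1) (j : 'I_(m + m.+1).+1) :
  (i <= j)%N -> (a i <= dmap a j)%N.
Proof.
rewrite /= /dmap_fun; have [[j' -> ->]|[j' -> ->]] := dsplitP j; rewrite /= => ij.
  exact: smor_homo.
by rewrite (leq_trans (ltnW (ltn_ord (a i)))) // leq_addr.
Qed.

End Doubling.

Section Windows.
Variable R : realType.
Implicit Types (x y z s : R).

(** For [t] in the simplex the total mass is 2, so this is not a point of a simplex but encodes the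
    step function on [[0, 2]]. *)
Definition double n (t : 'rV[R]_n.+1) : 'rV[R]_(n + n.+1).+1 :=
  simplex_push (dinl n) t + simplex_push (dinr n) t.

Lemma psum_inr n (t : 'rV[R]_n.+1) k :
  psum (simplex_push (dinr n) t) k = psum t (k - n.+1).
Proof. by apply: psum_push => i /=; rewrite ltn_subRL. Qed.

Lemma psum_double n (t : 'rV[R]_n.+1) k :
  psum (double t) k = psum t k + psum t (k - n.+1).
Proof. by rewrite psumD psum_inr; congr (_ + _); apply: psum_push. Qed.

Lemma simplex_pushD m n (a : smor m n) (t t' : 'rV[R]_m.+1) :
  simplex_push a (t + t') = simplex_push a t + simplex_push a t'.
Proof.
apply/rowP => j; rewrite !mxE -big_split; apply: eq_bigr => i _.
by rewrite mxE.
Qed.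

Lemma double_push m n (a : smor m n) (t : 'rV[R]_m.+1) :
  double (simplex_push a t) = simplex_push (dmap a) (double t).
Proof.
rewrite /double simplex_pushD -!simplex_push_comp.
congr (simplex_push _ t + simplex_push _ t).
  by apply: smor_eq => i /=; rewrite /dmap_fun dsplit_inl.
by apply: smor_eq => i /=; rewrite /dmap_fun dsplit_inr.
Qed.

Definition clip x y z : R := Num.max x (Num.min y z).

(* The step function of [t] restricted to [[x, y]] and rescaled to [[0, 1]]. *)
Definition window x y n (t : 'rV[R]_n.+1) : 'rV[R]_n.+1 :=
  \row_i ((clip x y (psum t i.+1) - clip x y (psum t i)) / (y - x)).

Lemma psum_window x y n (t : 'rV[R]_n.+1) k :
  psum (window x y t) k = (clip x y (psum t k) - clip x y 0) / (y - x).
Proof.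
have key l : (l <= n.+1)%N ->
    psum (window x y t) l = (clip x y (psum t l) - clip x y 0) / (y - x).
  elim: l => [|l IH] ln; first by rewrite !psum0 subrr mul0r.
  have -> := psumS (window x y t) (Ordinal ln).
  by rewrite (IH (ltnW ln)) mxE /= -mulrDl addrC addrA subrK.
have [/key//|/ltnW nk] := leqP k n.+1.
by rewrite psum_all // -(psum_all _ (ltnSn n)) key // !psum_all.
Qed.

(** Windows act on the domain of the step function, pushing forward acts on its values; on partial
    sums the former is clipping and rescaling, the latter reindexing. *)
Lemma window_push x y m n (a : smor m n) (t : 'rV[R]_m.+1) :
  window x y (simplex_push a t) = simplex_push a (window x y t).
Proof.
apply: psum_inj => k; have [l _ ak] := smor_downset a k.
by rewrite psum_window !(psum_push _ ak) psum_window.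
Qed.

Lemma clip_le x y : {homo clip x y : z z' / z <= z'}.
Proof.
move=> z z' zz'.
by rewrite /clip ge_max !le_max lexx /= le_min !ge_min lexx zz' !orbT.
Qed.

Lemma window_simplex x y n (t : 'rV[R]_n.+1) : (forall i, 0 <= t ord0 i) ->
  0 <= x < y -> y <= psum t n.+1 -> simplex (window x y t).
Proof.
move=> t0 /andP[x0 xy] yt; split=> [i|].
  rewrite mxE divr_ge0 ?subr_ge0 ?(ltW xy) //.
  by apply: clip_le; exact: psum_le.
rewrite -(psum_all _ (ltnSn n)) psum_window /clip (min_l yt) (max_r (ltW xy)).
rewrite (min_r (le_trans x0 (ltW xy))) (max_l x0) divff //.
by rewrite subr_eq0 gt_eqF.
Qed.

(** If either inequality fails, both ends of the interval belonging to [i] are clipped to the same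
    end of [[x, y]], and the coordinate vanishes. *)
Lemma window_supp x y n (t : 'rV[R]_n.+1) i : (forall i, 0 <= t ord0 i) ->
  x < y -> window x y t ord0 i != 0 -> psum t i < y /\ x < psum t i.+1.
Proof.
move=> t0 xy; rewrite mxE => w0; split; rewrite ltNge; apply: contra w0 => h.
  have h' : y <= psum t i.+1 by apply: le_trans h _; exact: psum_le.
  by rewrite /clip !min_l // subrr mul0r.
have h' : psum t i <= x by apply: le_trans h; exact: psum_le.
rewrite /clip (min_r (le_trans h (ltW xy))) (min_r (le_trans h' (ltW xy))).
by rewrite !max_l // subrr mul0r.
Qed.

(* The parameter [l] of the homotopy in terms of [s]; clipping makes the
   homotopies continuous on the whole line. *)
Definition cut s : R := (1 + clip 0 1 s) / 2.

Lemma cut_bounds s : 1 / 2 <= cut s <= 1.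
Proof.
have [c0 c1] : 0 <= clip 0 1 s /\ clip 0 1 s <= 1.
  by rewrite /clip le_max lexx ge_max ler01 ge_min lexx.
by apply/andP; split; rewrite /cut; lra.
Qed.

Lemma cut0 : cut 0 = 1 / 2.
Proof. by rewrite /cut /clip min_r // max_l // addr0. Qed.

Lemma cut1 : cut 1 = 1.
Proof. by rewrite /cut /clip min_l // max_r //; lra. Qed.

Definition lo n (t : 'rV[R]_n.+1) s := window 0 (cut s) t.

Definition hi n (t : 'rV[R]_n.+1) s := window (cut s) (2 * cut s) (double t).

Lemma double_ge0 n (t : 'rV[R]_n.+1) i : simplex t -> 0 <= double t ord0 i.
Proof. by move=> [t0 _]; rewrite !mxE addr_ge0 // sumr_ge0. Qed.

Lemma lo_simplex n (t : 'rV[R]_n.+1) s : simplex t -> simplex (lo t s).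
Proof.
move=> st; have /andP[c0 c1] := cut_bounds s.
apply: window_simplex; first by case: st.
  by lra.
by rewrite psum_all //; case: st => _ ->.
Qed.

Lemma hi_simplex n (t : 'rV[R]_n.+1) s : simplex t -> simplex (hi t s).
Proof.
move=> st; have /andP[c0 c1] := cut_bounds s.
apply: window_simplex; first by move=> i; exact: double_ge0.
  by lra.
rewrite psum_double !psum_all; [|lia|lia].
by have [_ ->] := st; lra.
Qed.

Lemma lo_push m n (a : smor m n) (t : 'rV[R]_m.+1) s :
  lo (simplex_push a t) s = simplex_push a (lo t s).
Proof. exact: window_push. Qed.

Lemma hi_push m n (a : smor m n) (t : 'rV[R]_m.+1) s :
  hi (simplex_push a t) s = simplex_push (dmap a) (hi t s).
Proof. by rewrite /hi double_push window_push. Qed.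

(** Since [cut s <= 1], both points are windows of the one nondecreasing step function on [[0, 2]],
    over the adjacent intervals [[0, cut s]] and [[cut s, 2 * cut s]]. *)
Lemma lo_le_hi n (t : 'rV[R]_n.+1) s i j : simplex t ->
  lo t s ord0 i != 0 -> hi t s ord0 j != 0 -> (i <= j)%N.
Proof.
move=> st; have /andP[c0 c1] := cut_bounds s.
move=> /window_supp [|| ti _]; [by case: st|by lra|].
move=> /window_supp [|| _ tj]; [by move=> k; exact: double_ge0|by lra|].
rewrite leqNgt; apply/negP => ji.
have : psum (double t) j.+1 <= psum t i.
  rewrite psum_double [(j.+1 - _)%N](_ : _ = 0)%N ?psum0 ?addr0.
    by apply: psum_le => //; case: st.
  by apply/eqP; rewrite subn_eq0 (leq_trans ji) // ltnW.
by move=> h; have := lt_trans (lt_le_trans tj h) ti; rewrite ltxx.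
Qed.

(** At parameter 0 the window is [[1/2, 1]], while the second copy of [t] only starts at 1. *)
Lemma hi0_supp n (t : 'rV[R]_n.+1) j : simplex t ->
  hi t 0 ord0 j != 0 -> (j <= n)%N.
Proof.
move=> st; rewrite /hi cut0.
move=> /window_supp [|| tj _]; [by move=> k; exact: double_ge0|by lra|].
rewrite leqNgt; apply/negP => nj; move: tj.
rewrite psum_double psum_all //; have [_ ->] := st.
by have := psum_ge0 (j - n.+1) st; lra.
Qed.

Lemma lo1 n (t : 'rV[R]_n.+1) : simplex t -> lo t 1 = t.
Proof.
move=> st; apply: psum_inj => k; rewrite psum_window cut1 /clip.
have := psum_le1 k st; have := psum_ge0 k st => k0 k1.
by rewrite min_r // max_r // (min_r ler01) maxxx !subr0 divr1.
Qed.

(** At parameter 1 the window is [[1, 2]], which is exactly the second copy. *)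
Lemma hi1 n (t : 'rV[R]_n.+1) : simplex t -> hi t 1 = simplex_push (dinr n) t.
Proof.
move=> st; apply: psum_inj => k; rewrite psum_window cut1 psum_inr psum_double /clip.
rewrite (_ : 2 * 1 - 1 = 1 :> R) ?divr1; last by lra.
rewrite (_ : Num.max 1 (Num.min (2 * 1) 0) = 1 :> R); last first.
  by rewrite min_r ?max_l //; lra.
have k0 := psum_ge0 k st; have k1 := psum_le1 k st.
have [kn|nk] := leqP k n.
  have -> : (k - n.+1 = 0)%N by apply/eqP; rewrite subn_eq0 ltnW.
  by rewrite psum0 addr0 min_r ?max_l; lra.
rewrite psum_all //; have [_ ->] := st.
have k0' := psum_ge0 (k - n.+1) st; have k1' := psum_le1 (k - n.+1) st.
by rewrite min_r ?max_r; lra.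
Qed.

Lemma clip_continuous (T : topologicalType) (x y z : T -> R) :
  continuous x -> continuous y -> continuous z ->
  continuous (fun k => clip (x k) (y k) (z k)).
Proof.
by move=> cx cy cz; apply: max_fun_continuous => //; exact: min_fun_continuous.
Qed.

Lemma window_continuous (T : topologicalType) (x y : T -> R) n
    (u : T -> 'rV[R]_n.+1) i : continuous x -> continuous y ->
  (forall i, continuous (fun k => u k ord0 i)) -> (forall k, x k < y k) ->
  continuous (fun k => window (x k) (y k) (u k) ord0 i).
Proof.
move=> cx cy cu xy; under [X in continuous X]eq_fun do rewrite mxE.
apply: mul_fun_continuous.
  by apply: sub_fun_continuous; apply: clip_continuous => //; exact: psum_continuous.
apply: inv_fun_continuous; first exact: sub_fun_continuous.
by move=> k; rewrite subr_eq0 gt_eqF.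
Qed.

Lemma cut_continuous (T : topologicalType) (s : T -> R) :
  continuous s -> continuous (fun k => cut (s k)).
Proof.
move=> cs; apply: mul_fun_continuous; last by move=> k; exact: cvg_cst.
apply: add_fun_continuous; first by move=> k; exact: cvg_cst.
by apply: clip_continuous => // k; exact: cvg_cst.
Qed.

Lemma push_continuous (T : topologicalType) m n (a : smor m n)
    (u : T -> 'rV[R]_m.+1) i :
  (forall i, continuous (fun k => u k ord0 i)) ->
  continuous (fun k => simplex_push a (u k) ord0 i).
Proof.
move=> cu; under [X in continuous X]eq_fun do rewrite mxE.
exact: sum_fun_continuous.
Qed.

Lemma lo_continuous (T : topologicalType) n (u : T -> 'rV[R]_n.+1) (s : T -> R) i :
  (forall i, continuous (fun k => u k ord0 i)) -> continuous s ->
  continuous (fun k => lo (u k) (s k) ord0 i).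
Proof.
move=> cu cs; apply: window_continuous => //.
- by move=> k; exact: cvg_cst.
- exact: cut_continuous.
- by move=> k; have := cut_bounds (s k); lra.
Qed.

Lemma hi_continuous (T : topologicalType) n (u : T -> 'rV[R]_n.+1) (s : T -> R) i :
  (forall i, continuous (fun k => u k ord0 i)) -> continuous s ->
  continuous (fun k => hi (u k) (s k) ord0 i).
Proof.
move=> cu cs; apply: window_continuous => //.
- exact: cut_continuous.
- apply: mul_fun_continuous; first by move=> k; exact: cvg_cst.
  exact: cut_continuous.
- move=> {}i; under [X in continuous X]eq_fun do rewrite mxE.
  by apply: add_fun_continuous; exact: push_continuous.
- by move=> k; have := cut_bounds (s k); lra.
Qed.

End Windows.

Lemma pair_cst_continuous (T U : topologicalType) (z : U) :
  continuous (fun t : T => (t, z)).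
Proof. by move=> t; apply: cvg_pair; [exact: cvg_id|exact: cvg_cst]. Qed.

(** * Homotopies between realizations *)

Section RealizationMaps.
Variables (R : realType) (X : sSet).

Lemma realization_continuous (Z : topologicalType) (h : realization R X -> Z) :
  (forall n (x : X n), continuous (fun t => h (real_point x t))) -> continuous h.
Proof.
move=> ch; apply/quotient_continuous.
pose h' (i : {classic {n : nat & X n}}) (t : cell_space R i) :=
  h (real_point (projT2 i) t).
rewrite (_ : h \o _ = fun z : cells R X => h' (projT1 z) (projT2 z)).
  by apply: (@sigT_continuous _ _ _ h') => -[n x]; exact: ch.
by apply/funext => -[[n x] t].
Qed.

(* The product of the quotient map onto the realization with the identity of
   the line is handled by currying, the line being locally compact. *)
Lemma realization_homotopy_continuous (Z : topologicalType)
    (h : realization R X -> R -> Z) :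
  (forall n (x : X n),
     continuous (fun ts : set_type (@simplex R n) * R => h (real_point x ts.1) ts.2)) ->
  continuous (fun xs : realization R X * R => h xs.1 xs.2).
Proof.
move=> ch.
have -> : (fun xs : realization R X * R => h xs.1 xs.2) = uncurry h.
  by apply/funext => -[].
apply: continuous_uncurry_regular.
- exact: locally_compactR.
- exact: uniform_regular.
- pose h' : realization R X -> {compact-open, R -> Z} := h.
  change (continuous h').
  apply: realization_continuous => n x.
  exact: (continuous_curry_fun (ch n x)).
- apply: real_ind => -[[n x] t].
  have [_ /(_ t)] := continuous_curry (ch n x).
  exact.
Qed.

End RealizationMaps.

Lemma real_point_ind (R : realType) (X : sSet) (P : realization R X -> Prop) :
  (forall n (x : X n) t, P (real_point x t)) -> forall z, P z.
Proof. by move=> Px; apply: real_ind => -[[n x] t]; exact: Px. Qed.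

Section Equivalence.
Variables (R : realType) (gT : finGroupType) (Y B : GsSet gT).
Variables (p : smap Y B) (sec : forall n, B n -> Y n).

Local Notation P n :=
  (pairs (fun (i : 'I_n.+1) (j : 'I_(n + n.+1).+1) => (i <= j)%N)).

(* [zeta y (a, b)] stands for the simplex obtained from [y] by restricting its
   part in [D] along [a], and the total chain of [y] along [b] as part in [C]. *)
Variable zeta : forall n, Y n -> smap (P n) Y.

Hypothesis pG : forall g n (y : Y n), p n (gs_act Y g n y) = gs_act B g n (p n y).
Hypothesis secK : forall n (z : B n), p n (sec z) = z.
Hypothesis zeta_sop : forall m n (a : smor m n) (y : Y n) N (k : P m N) (l : P n N),
  (proj1_sig l).1 = smor_comp a (proj1_sig k).1 ->
  (proj1_sig l).2 = smor_comp (dmap a) (proj1_sig k).2 ->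
  zeta (sop a y) N k = zeta y N l.
Hypothesis zeta_id : forall n (y : Y n) (k : P n n),
  proj1_sig k = (smor_id n, dinr n) -> zeta y n k = y.
Hypothesis zetaG : forall g n (y : Y n) N (k : P n N),
  zeta (gs_act Y g n y) N k = gs_act Y g N (zeta y N k).
Hypothesis p_zeta : forall n (y : Y n) N (k : P n N),
  p N (zeta y N k) = sop (proj1_sig k).1 (p n y).
Hypothesis zeta_low : forall n (y : Y n) N (k : P n N),
  (forall j, ((proj1_sig k).2 j <= n)%N) ->
  zeta y N k = zeta (sec (p n y)) N k.

Local Notation splx n := (set_type (@simplex R n)).

(** By [pairs_point_eq] all simplices [k] and points [w] representing the pair of [lo] and [hi] give
    the same value. Characterizing the value by all of them allows each later property to use the
    most convenient one. *)
Lemma zeta_point_ex n (y : Y n) (t : splx n) s : exists z : realization R Y,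
  forall N (k : P n N) w, simplex_push (proj1_sig k).1 (\val w) = lo (\val t) s ->
    simplex_push (proj1_sig k).2 (\val w) = hi (\val t) s ->
    z = real_point (zeta y N k) w.
Proof.
have st := simplexP t.
have [k [k1 k2] _] := pairs_lift (lo_simplex s st) (hi_simplex s st)
  (fun i j => @lo_le_hi R n (\val t) s i j st).
have gr := breaks2_grid (lo_simplex s st) (hi_simplex s st).
exists (real_point (zeta y _ k) (to_simplex (gaps_simplex gr))) => N l w l1 l2.
by apply: pairs_point_eq; rewrite ?l1 ?l2.
Qed.

Definition zeta_point n (y : Y n) (t : splx n) (s : R) : realization R Y :=
  projT1 (cid (zeta_point_ex y t s)).

Lemma zeta_pointE n (y : Y n) (t : splx n) s N (k : P n N) w :
  simplex_push (proj1_sig k).1 (\val w) = lo (\val t) s ->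
  simplex_push (proj1_sig k).2 (\val w) = hi (\val t) s ->
  zeta_point y t s = real_point (zeta y N k) w.
Proof. exact: (projT2 (cid (zeta_point_ex y t s))). Qed.

Lemma zeta_point_rep n (t : splx n) s : exists N (k : P n N) (w : splx N),
  [/\ simplex_push (proj1_sig k).1 (\val w) = lo (\val t) s,
      simplex_push (proj1_sig k).2 (\val w) = hi (\val t) s &
      forall j, hi (\val t) s ord0 ((proj1_sig k).2 j) != 0].
Proof.
have st := simplexP t.
have [k [k1 k2] k3] := pairs_lift (lo_simplex s st) (hi_simplex s st)
  (fun i j => @lo_le_hi R n (\val t) s i j st).
have gr := breaks2_grid (lo_simplex s st) (hi_simplex s st).
by exists _, k, (to_simplex (gaps_simplex gr)).
Qed.

Lemma zeta_point_sop m n (a : smor m n) (y : Y n) (t : splx m) s :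
  zeta_point (sop a y) t s = zeta_point y (simplex_map a t) s.
Proof.
have [N [k [w [k1 k2 _]]]] := zeta_point_rep t s.
have kL i j :
    (smor_comp a (proj1_sig k).1 i <= smor_comp (dmap a) (proj1_sig k).2 j)%N.
  exact: dmap_ge (proj2_sig k i j).
(* The same [w] serves over [y], as [lo] and [hi] commute with pushing forward along [a] and
   [dmap a] respectively. *)
pose l : P n N := exist (fun ab : smor N n * smor N (n + n.+1) =>
  forall i j, (ab.1 i <= ab.2 j)%N) (_, _) kL.
rewrite (zeta_pointE _ k1 k2) (@zeta_pointE _ _ _ _ _ l w).
- by congr real_point; exact: zeta_sop.
- by rewrite /= simplex_push_comp k1 lo_push.
- by rewrite [LHS]simplex_push_comp k2 hi_push.
Qed.

Lemma zeta_point1 n (y : Y n) t : zeta_point y t 1 = real_point y t.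
Proof.
have st := simplexP t.
have kL i j : (smor_id n i <= dinr n j)%N.
  by rewrite /= (leq_trans (ltnW (ltn_ord i))) // leq_addr.
pose k : P n n := exist (fun ab : smor n n * smor n (n + n.+1) =>
  forall i j, (ab.1 i <= ab.2 j)%N) (_, _) kL.
rewrite (@zeta_pointE _ _ _ _ _ k t).
- by rewrite zeta_id.
- by rewrite /= simplex_push_id lo1.
- by rewrite /= hi1.
Qed.

(** The part in [C] only meets the first copy, so [zeta_low] applies and the value depends on
    [p n y] alone. Hence a section [sec] that is neither simplicial nor equivariant still induces a
    G-map on realizations. *)
Lemma zeta_point0 n (y : Y n) t :
  zeta_point y t 0 = zeta_point (sec (p n y)) t 0.
Proof.
have [N [k [w [k1 k2 k3]]]] := zeta_point_rep t 0.
rewrite !(zeta_pointE _ k1 k2) zeta_low // => j.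
exact: hi0_supp (simplexP t) (k3 j).
Qed.

Lemma zeta_point_act g n (y : Y n) t s :
  zeta_point (gs_act Y g n y) t s = real_map (gs_act Y g) (zeta_point y t s).
Proof.
have [N [k [w [k1 k2 _]]]] := zeta_point_rep t s.
by rewrite !(zeta_pointE _ k1 k2) real_mapE zetaG.
Qed.

Lemma coordinate_continuous n i : continuous (fun t : splx n => \val t ord0 i).
Proof.
move=> t; apply: (@continuous_comp _ _ _ (fun t : splx n => \val t)
  (fun u : 'rV[R]_n.+1 => u ord0 i)).
  exact: initial_continuous.
exact: coord_continuous.
Qed.

Lemma coordinate1_continuous n i :
  continuous (fun ts : splx n * R => \val ts.1 ord0 i).
Proof.
move=> ts; apply: (@continuous_comp _ _ _ fst (fun t : splx n => \val t ord0 i)).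
  exact: cvg_fst.
exact: coordinate_continuous.
Qed.

Lemma snd_fun_continuous n : continuous (fun ts : splx n * R => ts.2).
Proof. by move=> ts; exact: cvg_snd. Qed.

Lemma zeta_point_continuous n (y : Y n) :
  continuous (fun ts : splx n * R => zeta_point y ts.1 ts.2).
Proof.
apply: (@pairs_continuous R Y _ _ _ (zeta y) _
  (fun ts : splx n * R => lo (\val ts.1) ts.2) (fun ts => hi (\val ts.1) ts.2)).
- by move=> ts; exact: lo_simplex (simplexP _).
- by move=> ts; exact: hi_simplex (simplexP _).
- move=> i; apply: lo_continuous; last exact: snd_fun_continuous.
  by move=> j; exact: coordinate1_continuous.
- move=> i; apply: hi_continuous; last exact: snd_fun_continuous.
  by move=> j; exact: coordinate1_continuous.
- by move=> ts i j; apply: lo_le_hi; exact: simplexP.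
- by move=> ts N k w; exact: zeta_pointE.
Qed.

Definition cell_fun (X : sSet) (Z : Type) (h : forall n, X n -> splx n -> Z)
    (z : cells R X) : Z :=
  h _ (projT2 (projT1 z)) (projT2 z).

Lemma realization_lift (X : sSet) (Z : Type) (h : forall n, X n -> splx n -> Z) :
  (forall m n (a : smor m n) (x : X n) t,
     h m (sop a x) t = h n x (simplex_map a t)) ->
  exists h' : realization R X -> Z,
    forall n (x : X n) t, h' (real_point x t) = h n x t.
Proof.
move=> ha; exists (quot_lift (cell_fun h)) => n x t.
by rewrite [LHS]quot_liftE // => _ _ [*]; exact: ha.
Qed.

Theorem zeta_equivalence : G_homotopy_equivalent R Y B.
Proof.
have [hY hYE] := realization_lift (fun m n a (y : Y n) t =>
  funext (zeta_point_sop a y t)).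
have [f' f'E] : exists f' : realization R B -> realization R Y,
    forall n (x : B n) t, f' (real_point x t) = zeta_point (sec x) t 0.
  apply: (@realization_lift _ _ (fun n (x : B n) t => zeta_point (sec x) t 0)).
  (* [sop a (sec x)] and [sec (sop a x)] may differ, but they have the same image under [p], which
     is all that matters at parameter 0. *)
  move=> m n a x t; rewrite -zeta_point_sop [RHS]zeta_point0.
  congr (zeta_point (sec _) _ _).
  by rewrite smap_nat secK.
(* On the side of [B] the homotopy stays in each cell and moves [t] to its window [[0, cut s]]. At 0
   this is [p] after [f'], because [p_zeta] keeps only the part in [D]. *)
have [hB hBE] : exists hB : realization R B -> R -> realization R B,
    forall n (x : B n) t, hB (real_point x t) =
    fun s => real_point x (to_simplex (lo_simplex s (simplexP t))).
  apply: (@realization_lift _ _ (fun n (x : B n) t s =>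
    real_point x (to_simplex (lo_simplex s (simplexP t))))).
  move=> m n a x t; apply/funext => s; apply: point_push.
  by rewrite /= lo_push.
have real_mapp (X Z : sSet) (f : smap X Z) n (x : X n) t :
    real_map f (real_point x t) = real_point (f n x) t by exact: real_mapE.
have f'c : continuous f'.
  apply: realization_continuous => n x.
  under [X in continuous X]eq_fun do rewrite f'E.
  move=> t; apply: (@continuous_comp _ _ _ (fun t : splx n => (t, 0 : R))
    (fun ts : splx n * R => zeta_point (sec x) ts.1 ts.2)).
    exact: pair_cst_continuous.
  exact: zeta_point_continuous.
exists (real_map p), f'; split.
- split; first exact: real_map_continuous.
  by move=> g; apply: real_point_ind => n y t; rewrite /= !real_mapp pG.
- split=> // g; apply: real_point_ind => n x t.
  (* Again [sec] is compared with its translate by [g] only through [p]. *)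
  rewrite /= real_mapp !f'E -zeta_point_act.
  by rewrite [RHS]zeta_point0 pG secK.
- exists (fun xs => hY xs.1 xs.2); split.
  + apply: continuous_subspaceT; apply: realization_homotopy_continuous => n y.
    under [X in continuous X]eq_fun do rewrite hYE.
    exact: zeta_point_continuous.
  + apply: real_point_ind => n y t.
    by rewrite /= hYE real_mapp f'E zeta_point0.
  + by apply: real_point_ind => n y t; rewrite /= hYE zeta_point1.
  + move=> g x s _; move: x; apply: real_point_ind => n y t.
    by rewrite /= real_mapp !hYE zeta_point_act.
- exists (fun xs => hB xs.1 xs.2); split.
  + apply: continuous_subspaceT; apply: realization_homotopy_continuous => n x.
    under [X in continuous X]eq_fun do rewrite hBE.
    move=> ts; apply: (@continuous_comp _ _ _ (fun ts : splx n * R =>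
      to_simplex (lo_simplex ts.2 (simplexP ts.1))) (real_point x)).
      apply: to_simplex_continuous => i; apply: lo_continuous.
        by move=> j; exact: coordinate1_continuous.
      exact: snd_fun_continuous.
    exact: point_continuous.
  + apply: real_point_ind => n x t.
    rewrite /= hBE f'E; have [N [k [w [k1 k2 _]]]] := zeta_point_rep t 0.
    rewrite (zeta_pointE _ k1 k2) real_mapp p_zeta secK.
    by apply/esym/point_push.
  + apply: real_point_ind => n x t.
    rewrite /= hBE; congr real_point; apply: val_inj.
    by rewrite /= lo1 //; exact: simplexP.
  + move=> g x s _; move: x; apply: real_point_ind => n x t.
    by rewrite /= real_mapp !hBE real_mapp.
Qed.

End Equivalence.

Lemma sf_map_irr (D : category) (F : sfunctor D) n (s : nerve D n)
    (i j : ordcat n) (p q : hom i j) m (x : F (s i) m) :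
  sf_map F (fmor s p) m x = sf_map F (fmor s q) m x.
Proof. by rewrite (nerve_mor_irr s p q). Qed.

(** * The homotopy pushdown *)

Section Eqhom.

Lemma eqhom_comp (C : category) (X Y Z : C) (e : X = Y) (e' : Y = Z) :
  eqhom e' \oc eqhom e = eqhom (etrans e e').
Proof. by case: _ / e'; rewrite comp1m. Qed.

Lemma fmor_eqhom (C D : category) (K : functor C D) (X Y : C) (e : X = Y) :
  fmor K (eqhom e) = eqhom (f_equal (fob K) e).
Proof. by case: _ / e; rewrite fmor1. Qed.

Lemma eqhom_op (C : category) (X Y : C) (e : X = Y) :
  @eqhom (op C) X Y e = @eqhom C Y X (esym e).
Proof. by case: _ / e. Qed.

End Eqhom.

Section PushdownAxioms.
Variables (gT : finGroupType) (D C : Gcategory gT) (S : functor D C).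
Hypothesis hS : equivariant S.
Variable F : right_Gfunctor D.

(** For the unit and multiplication axioms, [bar_eq] leaves three components: the chains agree by
    the strict action on [D], the elements of [F] by the axioms of [F], and the maps to [c] by
    naturality of the transports, whose composites agree by proof irrelevance. *)
Lemma pushdown_axioms : is_right_Gfunctor (pushdown_eta hS F).
Proof.
split.
- move=> c n [s [x f]].
  have e : compF (gact D 1%g) s = s.
    apply: (@functor_eq _ _ (compF (gact D 1%g) s) s (fun i => gact1_ob (s i))).
    move=> i j ij.
    exact: (functor_hom_eq (gact1 D) (fmor s ij)).
  apply: (bar_eq (F := F) (T := homS S c) (e := e)) => /=.
    rewrite (Prop_irrelevance (functor_ob_eq e ord0) (gact1_ob (s ord0))).
    exact: (eta1 (rg_axioms F)).
  rewrite eqhom_op (fmor_eqhom S) /homS_act !compmA.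
  have -> : eqhom (gact1_ob c) \oc fmor (gact C 1%g) f =
    f \oc eqhom (gact1_ob (S (s ord_max))) by exact: (functor_hom_eq (gact1 C)).
  by rewrite -!compmA !eqhom_comp eqhom1 compm1.
- move=> g h c n [s [x f]]; apply: esym.
  have e : compF (gact D (g * h)%g) s = compF (gact D g) (compF (gact D h) s).
    apply: (@functor_eq _ _ (compF (gact D (g * h)%g) s)
      (compF (gact D g) (compF (gact D h) s)) (fun i => gactM_ob g h (s i))).
    move=> i j ij.
    exact: (functor_hom_eq (gactM D g h) (fmor s ij)).
  apply: (bar_eq (F := F) (T := homS S (gact C g (gact C h c))) (e := e)) => /=.
    rewrite (Prop_irrelevance (functor_ob_eq e ord0) (gactM_ob g h (s ord0))).
    exact: esym (etaM (rg_axioms F) _ _ _).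
  rewrite eqhom_op (fmor_eqhom S) /homS_act fmorM !compmA.
  have -> : eqhom (gactM_ob g h c) \oc fmor (gact C (g * h)%g) f =
    fmor (gact C g) (fmor (gact C h) f) \oc eqhom (gactM_ob g h (S (s ord_max))).
    exact: (functor_hom_eq (gactM C g h)).
  rewrite -!compmA; congr (_ \oc _); rewrite (fmor_eqhom (gact C g)) !eqhom_comp.
  by congr eqhom; exact: Prop_irrelevance.
- move=> g c c' psi n [s [x f]]; congr existT; congr pair => /=.
  by rewrite /homS_act fmorM compmA.
Qed.

End PushdownAxioms.

(** * Total chains, and the operation [zeta] on the homotopy colimit over [C] *)

Section Chains.
Variables (D C : category) (S : functor D C).

Section Total.
Variables (n : nat) (s : nerve D n) (c : C) (f : hom (S (s ord_max)) c).
Variable sg : nerve (undercat c) n.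

(** This is the order of the join of two copies of [[m]]. Keeping the vertices in a sum type lets
    objects and maps of the total chain compute by cases. *)
Definition tot_le m (u v : 'I_m.+1 + 'I_m.+1) : bool :=
  match u, v with
  | inl i, inl j | inr i, inr j => (i <= j)%N
  | inl _, inr _ => true
  | inr _, inl _ => false
  end.

Definition tot_ob (u : 'I_n.+1 + 'I_n.+1) : C :=
  match u with inl i => S (s i) | inr i => projT1 (sg i) end.

(* The chain [S X_0 -> ... -> S X_n -> C_0 -> ... -> C_n]. *)
Definition tot_mor (u v : 'I_n.+1 + 'I_n.+1) :
    tot_le u v -> hom (tot_ob u) (tot_ob v) :=
  match u, v return tot_le u v -> hom (tot_ob u) (tot_ob v) with
  | inl i, inl j => fun ij => fmor S (fmor s (ij : @hom (ordcat n) i j))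
  | inl i, inr j => fun=> projT2 (sg j) \oc f \oc
      fmor S (fmor s (leq_ord i : @hom (ordcat n) i ord_max))
  | inr i, inl j => fun ij => False_rect _ (notF ij)
  | inr i, inr j => fun ij => proj1_sig (fmor sg (ij : @hom (ordcat n) i j))
  end.

Lemma tot_mor1 u (uu : tot_le u u) : tot_mor uu = idm (tot_ob u).
Proof.
case: u uu => i ii /=; first by rewrite nerve_mor1 fmor1.
by rewrite (nerve_mor1 sg).
Qed.

Lemma tot_morM u v w (uv : tot_le u v) (vw : tot_le v w) (uw : tot_le u w) :
  tot_mor vw \oc tot_mor uv = tot_mor uw.
Proof.
case: u v w uv vw uw => i [] j // [] k // ij jk ik /=.
- by rewrite -!fmorM; congr fmor; exact: nerve_mor_irr.
- rewrite -!compmA -!fmorM; congr (_ \oc (_ \oc fmor S _)).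
  exact: nerve_mor_irr.
- rewrite !compmA (proj2_sig (fmor sg _)).
  by [].
- rewrite (_ : fmor sg ik = fmor sg (jk : @hom (ordcat n) j k) \oc
    fmor sg (ij : @hom (ordcat n) i j)) // -fmorM.
  exact: nerve_mor_irr.
Qed.

Arguments tot_mor : simpl never.

(** Here [i] stands for the last vertex of the part in [D]; the second condition provides the
    structure maps from [S (s i)] to the restricted total chain. *)
Definition chain_ok N (i : 'I_n.+1) (b : 'I_N.+1 -> 'I_n.+1 + 'I_n.+1) : Prop :=
  (forall j k : 'I_N.+1, (j <= k)%N -> tot_le (b j) (b k)) /\
  (forall j, tot_le (inl i) (b j)).

Program Definition chain N (i : 'I_n.+1) (b : 'I_N.+1 -> 'I_n.+1 + 'I_n.+1)
    (ib : chain_ok i b) : functor (ordcat N) (undercat (S (s i))) :=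
  @Functor (ordcat N) (undercat (S (s i)))
    (fun j => existT _ (tot_ob (b j)) (tot_mor (proj2 ib j)))
    (fun j k jk => exist _ (tot_mor (proj1 ib j k jk)) _) _ _.
Next Obligation.
by move=> N i b ib j k jk; exact: (tot_morM (proj2 ib j) (proj1 ib j k jk)).
Qed.
Next Obligation.
by move=> N i b ib j; apply: sig_eq; exact: tot_mor1.
Qed.
Next Obligation.
move=> N i b ib j k l kl jk; apply: sig_eq.
exact: esym (tot_morM (proj1 ib j k jk) (proj1 ib k l kl) _).
Qed.

End Total.

Lemma dsplit_le n (j k : 'I_(n + n.+1).+1) : (j <= k)%N ->
  tot_le (dsplit j) (dsplit k).
Proof.
have [[j' -> ->]|[j' -> ->]] := dsplitP j;
  have [[k' -> ->]|[k' -> ->]] := dsplitP k; rewrite //= ?leq_add2l // => jk.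
by move: jk; rewrite leqNgt (leq_trans (ltn_ord k')) // leq_addr.
Qed.

Lemma dsplit_ge n (i : 'I_n.+1) (j : 'I_(n + n.+1).+1) : (i <= j)%N ->
  tot_le (inl i) (dsplit j).
Proof. by have [[j' -> ->]|[j' -> ->]] := dsplitP j. Qed.

Variable F : sfunctor D.

Local Notation dpairs n :=
  (pairs (fun (i : 'I_n.+1) (j : 'I_(n + n.+1).+1) => (i <= j)%N)).
Local Notation YT := (tensor (pushdown S F) (nerve_under C)).
Local Notation BT := (tensor F (nerve_under D)).
Local Notation Ycls N := (quot_pi (@tensor_rel C (pushdown S F) (nerve_under C) N)).
Local Notation Bcls N := (quot_pi (@tensor_rel D F (nerve_under D) N)).
Local Notation under_pull f := (@sf_map (op C) (nerve_under C) _ _ f).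

(* The simplices of the homotopy colimit in normal form: the morphism from
   [S X_n] has been absorbed into the chain below [S X_n]. *)
Definition present N (s : nerve D N) (x : F (s ord0) N)
    (t : nerve (undercat (S (s ord_max))) N) :=
  tpair (F := pushdown S F) (T := nerve_under C) (c := S (s ord_max))
    (bar_mk (T := homS S (S (s ord_max))) x (idm (S (s ord_max)))) t.

Lemma present_eq N (s s' : nerve D N) (e : s = s') x x' t t' :
  sf_map F (eqhom (functor_ob_eq e ord0)) N x = x' ->
  under_pull (@eqhom (op C) _ _ (f_equal (fob S) (functor_ob_eq e ord_max))) N t = t' ->
  @present N s x t = @present N s' x' t'.
Proof.
case: _ / e in x' t' *; rewrite (eqhom1 (C := D)) sf_map1 => <-.
by rewrite (eqhom1 (C := op C)) (@sf_map1 (op C) (nerve_under C)) => <-.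
Qed.

(** This is the coend relation for [f], applied to the bar simplex whose last entry is an
    identity. *)
Lemma present_repr N (s : nerve D N) (x : F (s ord0) N) c
    (f : hom (S (s ord_max)) c) (t : nerve (undercat c) N) :
  Ycls N (tpair (F := pushdown S F) (T := nerve_under C) (c := c)
     (bar_mk (T := homS S c) x f) t) =
  Ycls N (@present N s x (under_pull (f : @hom (op C) c (S (s ord_max))) N t)).
Proof.
rewrite -(quot_eq (@TensorRel C (pushdown S F) (nerve_under C) N _ c f
  (bar_mk (T := homS S (S (s ord_max))) x (idm (S (s ord_max)))) t)) /=.
by rewrite compm1.
Qed.

Lemma Ycls_sop M N (d : smor M N) (s : nerve D N) (x : F (s ord0) N) c
    (f : hom (S (s ord_max)) c) (t : nerve (undercat c) N) :
  sop (s := YT) d (Ycls N (tpair (F := pushdown S F) (T := nerve_under C)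
    (c := c) (bar_mk (T := homS S c) x f) t)) =
  Ycls M (tpair (F := pushdown S F) (T := nerve_under C) (c := c)
    (bar_mk (T := homS S c) (s := sop d s)
       (sf_map F (fmor s (leq0n (d ord0) : @hom (ordcat N) ord0 (d ord0))) M (sop d x))
       (f \oc fmor S (fmor s (leq_ord (d ord_max) :
          @hom (ordcat N) (d ord_max) ord_max)))) (sop d t)).
Proof. exact: tensor_sopE. Qed.

Lemma present_sop M N (d : smor M N) (s : nerve D N) (x : F (s ord0) N) t :
  sop (s := YT) d (Ycls N (@present N s x t)) =
  Ycls M (@present M (sop d s)
    (sf_map F (fmor s (leq0n (d ord0) : @hom (ordcat N) ord0 (d ord0))) M (sop d x))
    (under_pull (fmor S (fmor s (leq_ord (d ord_max) :
       @hom (ordcat N) (d ord_max) ord_max)) :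
       @hom (op C) (S (s ord_max)) (S (s (d ord_max)))) M (sop d t))).
Proof.
by rewrite [LHS]Ycls_sop present_repr comp1m.
Qed.

Section Zeta.
Variables (n : nat) (s : nerve D n) (x : F (s ord0) n) (c : C).
Variables (f : hom (S (s ord_max)) c) (sg : nerve (undercat c) n).

Definition zeta_rep N (a : smor N n) b (ab : chain_ok (a ord_max) b) :=
  @present N (sop a s)
    (sf_map F (fmor s (leq0n (a ord0) : @hom (ordcat n) ord0 (a ord0))) N (sop a x))
    (chain f sg ab).

Lemma zeta_rep_eq N (a a' : smor N n) b b' ab ab' : a = a' -> b = b' ->
  @zeta_rep N a b ab = @zeta_rep N a' b' ab'.
Proof.
move=> aa' bb'; case: _ / aa' in ab' *; case: _ / bb' in ab' *.
by rewrite (Prop_irrelevance ab ab').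
Qed.

(** Restricting along [d] may move the last vertex of the part in [D]. The bar construction then
    inserts the map from the new last vertex to the old one, and composing it with the structure
    maps gives maps of the total chain again. *)
Lemma zeta_rep_sop M N (d : smor M N) (a : smor N n) b
    (ab : chain_ok (a ord_max) b) (ab' : chain_ok (smor_comp a d ord_max) (b \o d)) :
  Ycls M (zeta_rep ab') = sop (s := YT) d (Ycls N (zeta_rep ab)).
Proof.
rewrite present_sop; congr (Ycls M _).
have e : sop (smor_comp a d) s = sop d (sop a s :> nerve D N) by exact: sop_comp.
apply: (present_eq (e := e)).
  have -> : eqhom (functor_ob_eq e ord0) = idm (s (a (d ord0))).
    exact: (eqhom1 (C := D)).
  rewrite sf_map1 sop_comp -smap_nat -sf_mapM -fmorM.
  exact: (@sf_map_irr _ F n s ord0 (a (d ord0))).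
have -> : @eqhom (op C) _ _ (f_equal (fob S) (functor_ob_eq e ord_max)) =
  idm (S (s (a (d ord_max))) : op C) by exact: (eqhom1 (C := op C)).
rewrite sf_map1.
apply: (@undercat_functor_eq _ C (S (s (a (d ord_max)))) (chain f sg ab')
  (compF (under_pre (fmor S (fmor (sop a s : nerve D N) (leq_ord (d ord_max) :
       @hom (ordcat N) (d ord_max) ord_max))))
     (compF (chain f sg ab) (ordF d))) (fun=> erefl)) => [i|i j ij] /=.
  rewrite comp1m; apply: esym.
  exact: (@tot_morM n s c f sg (inl (a (d ord_max))) (inl (a ord_max)) (b (d i))
    (@smor_homo N n a (d ord_max) ord_max (leq_ord (d ord_max))) (proj2 ab (d i))
    (proj2 ab' i)).
by rewrite comp1m compm1; congr tot_mor; exact: Prop_irrelevance.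
Qed.

End Zeta.

(** This is compatibility with the coend relation: the total chain only involves the composite of
    [f], [g] and the structure maps of [sg], so [g] may be counted on either side. *)
Lemma zeta_rep_pull n (s : nerve D n) (x : F (s ord0) n) c c' (g : hom c c')
    (f : hom (S (s ord_max)) c) (sg : nerve (undercat c') n) N (a : smor N n) b
    (ab : chain_ok (a ord_max) b) :
  zeta_rep x (g \oc f) sg ab =
  zeta_rep x f (under_pull (g : @hom (op C) c' c) n sg) ab.
Proof.
congr present.
have key (u v : 'I_n.+1 + 'I_n.+1) (uv : tot_le u v) :
    tot_mor (s := s) (g \oc f) sg uv =
    tot_mor (s := s) f (compF (under_pre g) sg) uv.
  by case: u v uv => i [] j ij //; rewrite /tot_mor /= !compmA.
apply: (@undercat_functor_eq _ C (S (s (a ord_max))) (chain (g \oc f) sg ab)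
  (chain f (compF (under_pre g) sg) ab) (fun=> erefl)) => [i|i j ij] /=.
  by rewrite comp1m; exact: (key (inl (a ord_max))).
by rewrite comp1m compm1; exact: key.
Qed.

Definition zeta_pre n N (a : smor N n) b (ab : chain_ok (a ord_max) b)
    (z : {classic (tensor_pre (pushdown S F) (nerve_under C) n)}) :=
  let w : bar_simp F (homS S (projT1 z)) n := (projT2 z).1 in
  zeta_rep (projT2 w).1 (projT2 w).2 (projT2 z).2 ab.

Lemma pair_chain_ok n N (k : dpairs n N) :
  chain_ok ((proj1_sig k).1 ord_max) (@dsplit n \o (proj1_sig k).2).
Proof.
split=> [i j ij|j]; first exact/dsplit_le/smor_homo.
exact/dsplit_ge/(proj2_sig k).
Qed.

Definition zeta_fun n (y : YT n) N (k : dpairs n N) : YT N :=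
  quot_lift (fun z => Ycls N (zeta_pre (pair_chain_ok k) z)) y.

Lemma zeta_funE n (s : nerve D n) (x : F (s ord0) n) c
    (f : hom (S (s ord_max)) c) (sg : nerve (undercat c) n) N k :
  @zeta_fun n (Ycls n (tpair (F := pushdown S F) (T := nerve_under C) (c := c)
     (bar_mk (T := homS S c) x f) sg)) N k =
  Ycls N (zeta_rep x f sg (pair_chain_ok k)).
Proof.
rewrite [LHS]quot_liftE // => _ _ [c1 c2 g [s1 [x1 f1]] sg1].
by congr (Ycls N); exact: zeta_rep_pull.
Qed.

Lemma Y_ind n (P : YT n -> Prop) :
  (forall (s : nerve D n) (x : F (s ord0) n) c (f : hom (S (s ord_max)) c)
     (sg : nerve (undercat c) n),
     P (Ycls n (tpair (F := pushdown S F) (T := nerve_under C) (c := c)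
       (bar_mk (T := homS S c) x f) sg))) ->
  forall y, P y.
Proof. by move=> Px; apply: quot_ind => -[c [[s [x f]] sg]]; exact: Px. Qed.

Lemma zeta_fun_nat n (y : YT n) M N (d : smor M N) k :
  zeta_fun y (sop d k) = sop d (zeta_fun y k).
Proof.
elim/Y_ind: y => s x c f sg; rewrite !zeta_funE.
exact: zeta_rep_sop.
Qed.

Definition zeta n (y : YT n) : smap (dpairs n) YT :=
  @SMap (pairs _) YT (@zeta_fun n y) (fun M N d k => zeta_fun_nat y d k).

(** The total chain of [sop d y] is the one of [y] pulled back along [dmap d], so further
    restrictions just compose. *)
Lemma zeta_fun_sop m n (d : smor m n) (y : YT n) N k l :
  (proj1_sig l).1 = smor_comp d (proj1_sig k).1 ->
  (proj1_sig l).2 = smor_comp (dmap d) (proj1_sig k).2 ->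
  @zeta_fun m (sop d y) N k = @zeta_fun n y N l.
Proof.
elim/Y_ind: y => s x c f sg lk1 lk2.
rewrite Ycls_sop !zeta_funE; congr (Ycls N).
have ab : chain_ok (smor_comp d (proj1_sig k).1 ord_max)
    (dsum d \o (@dsplit m \o (proj1_sig k).2)).
  have [k1 k2] := pair_chain_ok k; split=> [i j ij|j] /=.
    move: (k1 i j ij) => /=.
    by case: (dsplit _) => i'; case: (dsplit _) => j' //=; exact: smor_homo.
  by move: (k2 j) => /=; case: (dsplit _) => j' //=; exact: smor_homo.
rewrite (@zeta_rep_eq _ s x c f sg N _ _ _ _ (pair_chain_ok l) ab) //; last first.
  by apply/funext => j /=; rewrite lk2 /= dsplit_map.
have e : sop (proj1_sig k).1 (sop d s) = sop (smor_comp d (proj1_sig k).1) s :> nerve D N.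
  exact/esym/sop_comp.
apply: (present_eq (e := e)).
  have -> : eqhom (functor_ob_eq e ord0) = idm (s (d ((proj1_sig k).1 ord0))).
    exact: (eqhom1 (C := D)).
  rewrite sf_map1 -smap_nat -sf_mapM -fmorM (sop_comp (s := F (s ord0))).
  exact: (@sf_map_irr _ F n s ord0 (d ((proj1_sig k).1 ord0))).
have -> : @eqhom (op C) _ _ (f_equal (fob S) (functor_ob_eq e ord_max)) =
  idm (S (s (d ((proj1_sig k).1 ord_max))) : op C) by exact: (eqhom1 (C := op C)).
rewrite sf_map1.
set s' := sop d s; set f' := f \oc _; set sg' := compF sg (ordF d).
(* The objects of the two total chains become convertible only after a case distinction on the
   vertex, so the comparison goes through [eqhom]. *)
pose ob_e (u : 'I_m.+1 + 'I_m.+1) : tot_ob s' sg' u = tot_ob s sg (dsum d u) :=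
  match u with inl _ => erefl | inr _ => erefl end.
have key (u v : 'I_m.+1 + 'I_m.+1) (uv : tot_le u v)
    (uv' : tot_le (dsum d u) (dsum d v)) :
    eqhom (ob_e v) \oc tot_mor (s := s') f' sg' uv =
    tot_mor (s := s) f sg uv' \oc eqhom (ob_e u).
  case: u v uv uv' => i [] j ij ij' //=; rewrite comp1m compm1 /tot_mor /=.
  - by congr (fmor S _); exact: nerve_mor_irr.
  - rewrite /f' -!compmA -fmorM -fmorM; congr (_ \oc (_ \oc fmor S _)).
    exact: nerve_mor_irr.
  - by congr (proj1_sig _); exact: (nerve_mor_irr sg).
apply: (@undercat_functor_eq _ C (S (s (d ((proj1_sig k).1 ord_max))))
  (chain (s := s') f' sg' (pair_chain_ok k)) (chain (s := s) f sg ab)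
  (fun i => ob_e _)) => [i|i j ij].
  rewrite (key (inl ((proj1_sig k).1 ord_max)) _ _ (proj2 ab i)).
  exact: compm1.
exact: key.
Qed.

Lemma zeta_fun_id n (y : YT n) k : proj1_sig k = (smor_id n, dinr n) ->
  zeta_fun y k = y.
Proof.
elim/Y_ind: y => s x c f sg; case: k => [[k1 k2] kL] /= [ek1 ek2].
rewrite zeta_funE present_repr; congr (Ycls n).
set ck := pair_chain_ok _.
have ab : chain_ok (smor_id n ord_max) (inr : 'I_n.+1 -> 'I_n.+1 + 'I_n.+1) by split.
rewrite (@zeta_rep_eq _ s x c f sg n _ _ _ _ ck ab) //; last first.
  by apply/funext => j /=; rewrite ek2 dsplit_inr.
have e : sop (smor_id n) s = s by exact: sop_id.
apply: (present_eq (e := e)).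
  have -> : eqhom (functor_ob_eq e ord0) = idm (s ord0) by exact: (eqhom1 (C := D)).
  by rewrite sf_map1 nerve_mor1 sf_map1 sop_id.
have -> : @eqhom (op C) _ _ (f_equal (fob S) (functor_ob_eq e ord_max)) =
  idm (S (s ord_max) : op C) by exact: (eqhom1 (C := op C)).
rewrite sf_map1.
apply: (@undercat_functor_eq _ C (S (s ord_max)) (chain f sg ab)
  (compF (under_pre f) sg) (fun=> erefl)) => [i|i j ij] /=.
  by rewrite comp1m /tot_mor nerve_mor1 fmor1 compm1.
rewrite comp1m compm1; congr (proj1_sig _); exact: (nerve_mor_irr sg).
Qed.

(** * The projection to the homotopy colimit over [D], and a section of it *)

Program Definition base_chain n (s : nerve D n) :
    functor (ordcat n) (undercat (s ord0)) :=
  @Functor (ordcat n) (undercat (s ord0))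
    (fun j => existT _ (s j) (fmor s (leq0n j : @hom (ordcat n) ord0 j)))
    (fun i j ij => exist _ (fmor s ij) _) _ _.
Next Obligation.
by move=> n s i j ij /=; rewrite -fmorM; exact: nerve_mor_irr.
Qed.
Next Obligation. by move=> n s i; apply: sig_eq; exact: fmor1. Qed.
Next Obligation. by move=> n s i j k jk ij; apply: sig_eq; exact: fmorM. Qed.

(** The chain in [D], viewed under its own first object, together with an element of [F] there is a
    normal form for simplices of the homotopy colimit over [D]. *)
Definition collapse_rep n
    (z : {classic (tensor_pre (pushdown S F) (nerve_under C) n)}) :=
  let w : bar_simp F (homS S (projT1 z)) n := (projT2 z).1 in
  tpair (F := F) (T := nerve_under D) (projT2 w).1 (base_chain (projT1 w)).

Definition collapse_fun n (y : YT n) : BT n :=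
  quot_lift (fun z => Bcls n (collapse_rep z)) y.

Lemma collapse_funE n (s : nerve D n) (x : F (s ord0) n) c
    (f : hom (S (s ord_max)) c) (sg : nerve (undercat c) n) :
  @collapse_fun n (Ycls n (tpair (F := pushdown S F) (T := nerve_under C) (c := c)
     (bar_mk (T := homS S c) x f) sg)) =
  Bcls n (tpair (F := F) (T := nerve_under D) x (base_chain s)).
Proof. by rewrite [LHS]quot_liftE // => _ _ [c1 c2 g [s1 [x1 f1]] sg1]. Qed.

Lemma collapse_fun_nat m n (d : smor m n) (y : YT n) :
  collapse_fun (sop d y) = sop d (collapse_fun y).
Proof.
elim/Y_ind: y => s x c f sg.
rewrite Ycls_sop !collapse_funE [RHS]tensor_sopE /tensor_pre_sop /=.
(* The first vertex may change under [d]; the coend relation moves the map from the old first vertex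
   to the new one from [F] into the chain. *)
rewrite (quot_eq (@TensorRel D F (nerve_under D) m _ _ (fmor s (leq0n (d ord0) :
  @hom (ordcat n) ord0 (d ord0))) (sop d x) (base_chain (sop d s : nerve D m)))).
congr (Bcls m (tpair _ _)).
apply: (@undercat_functor_eq _ D (s ord0) (compF (under_pre (fmor s (leq0n (d ord0) :
  @hom (ordcat n) ord0 (d ord0)))) (base_chain (sop d s : nerve D m)))
  (compF (base_chain s) (ordF d)) (fun=> erefl)) => [i|i j ij] /=.
  by rewrite comp1m -fmorM; exact: nerve_mor_irr.
by rewrite comp1m compm1.
Qed.

Definition collapse : smap YT BT :=
  @SMap YT BT collapse_fun (fun m n d y => collapse_fun_nat d y).

Lemma collapse_zeta_fun n (y : YT n) N k :
  collapse N (zeta_fun y k) = sop (proj1_sig k).1 (collapse n y).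
Proof.
rewrite -smap_nat; elim/Y_ind: y => s x c f sg.
by rewrite zeta_funE Ycls_sop [LHS]collapse_funE [RHS]collapse_funE.
Qed.

Definition forget (X : D) : functor (undercat X) D :=
  @Functor (undercat X) D (fun u => projT1 u) (fun u v p => proj1_sig p)
    (fun=> erefl) (fun _ _ _ _ _ => erefl).

Definition bar_data n := {s : nerve D n & F (s ord0) n}.

Lemma bar_data_eq n (s s' : nerve D n) (e : s = s') x x' :
  sf_map F (eqhom (functor_ob_eq e ord0)) n x = x' ->
  existT (fun s : nerve D n => F (s ord0) n) s x =
  existT (fun s : nerve D n => F (s ord0) n) s' x'.
Proof. by case: _ / e in x' *; rewrite (eqhom1 (C := D)) sf_map1 => <-. Qed.

(** Reads off the normal form: the underlying chain, with the element of [F] carried to its first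
    object. *)
Definition data_rep n (z : {classic (tensor_pre F (nerve_under D) n)}) : bar_data n :=
  let t : functor (ordcat n) (@undercat D (projT1 z)) := (projT2 z).2 in
  existT (fun s : nerve D n => F (s ord0) n) (compF (forget (projT1 z)) t)
    (sf_map F (projT2 (t ord0)) n (projT2 z).1).

Definition data n (q : BT n) : bar_data n := quot_lift (@data_rep n) q.

Lemma dataE n (z : {classic (tensor_pre F (nerve_under D) n)}) :
  data (Bcls n z) = data_rep z.
Proof.
apply: quot_liftE => _ _ [X X' phi x t].
have e : compF (forget X') t = compF (forget X) (compF (under_pre phi) t).
  exact: functor_eq_refl.
apply: (bar_data_eq (e := e)).
rewrite (_ : eqhom _ = idm (projT1 (fob t ord0))); last exact: (eqhom1 (C := D)).
by rewrite sf_map1 /= sf_mapM.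
Qed.

Definition const_chain n (X : C) : functor (ordcat n) (undercat X) :=
  @Functor (ordcat n) (undercat X) (fun=> existT _ X (idm X))
    (fun _ _ _ => idm _) (fun=> erefl) (fun _ _ _ _ _ => esym (comp1m _)).

(** The chain in [C] is constant at [S X_n]. This is in general incompatible with the last face,
    which replaces [X_n] by [X_(n-1)]. *)
Definition sec n (q : BT n) : YT n :=
  Ycls n (present (projT2 (data q)) (const_chain n _)).

Lemma secK n (q : BT n) : collapse n (sec q) = q.
Proof.
elim/quot_ind: q => -[X [x t]]; rewrite /sec dataE [LHS]collapse_funE /=.
rewrite (quot_eq (@TensorRel D F (nerve_under D) n _ _ (projT2 (fob t ord0)) x
  (base_chain (compF (forget X) t)))).
congr (Bcls n (tpair _ _)).
apply: (@undercat_functor_eq _ D X (compF (under_pre (projT2 (fob t ord0)))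
  (base_chain (compF (forget X) t))) t (fun=> erefl)) => [i|i j ij] /=.
  by rewrite comp1m; exact: (proj2_sig (fmor t _)).
by rewrite comp1m compm1.
Qed.

Lemma zeta_fun_low n (y : YT n) N (k : dpairs n N) :
  (forall j, ((proj1_sig k).2 j <= n)%N) ->
  @zeta_fun n y N k = zeta_fun (sec (collapse n y)) k.
Proof.
move=> kn; elim/Y_ind: y => s x c f sg.
have -> : collapse n (Ycls n (tpair (F := pushdown S F) (T := nerve_under C) (c := c)
  (bar_mk (T := homS S c) x f) sg)) =
  Bcls n (tpair (F := F) (T := nerve_under D) x (base_chain s)) by exact: collapse_funE.
rewrite /sec dataE (_ : data_rep _ = existT (fun s : nerve D n => F (s ord0) n) s x).
  rewrite !zeta_funE; congr (Ycls N).
  (* The bound on the second component excludes [inr]; that branch of the match is a dummy value. *)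
  pose b j := match dsplit ((proj1_sig k).2 j) with inl i => i | inr i => i end.
  have kb : @dsplit n \o (proj1_sig k).2 = (@inl _ _) \o b.
    apply/funext => j; rewrite /b /=.
    have [[i _ ->]|[i ki ->]] // := dsplitP ((proj1_sig k).2 j).
    by have := kn j; rewrite ki /= leqNgt ltnS leq_addr.
  have ab : chain_ok ((proj1_sig k).1 ord_max) ((@inl _ 'I_n.+1) \o b).
    by rewrite -kb; exact: pair_chain_ok.
  rewrite !(@zeta_rep_eq _ _ _ _ _ _ N _ _ _ _ (pair_chain_ok k) ab) //.
  congr present.
  (* All vertices now lie in the first copy, where both total chains consist of the images under [S]
     of the maps of [s]. *)
  apply: (@undercat_functor_eq _ C (S (s ((proj1_sig k).1 ord_max))) (chain f sg ab)
    (chain (idm (S (s ord_max))) (const_chain n _) ab) (fun=> erefl)) => [i|i j ij] /=.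
    by rewrite comp1m.
  by rewrite comp1m compm1.
have e : compF (forget (s ord0)) (base_chain s) = s.
  by case: (s) => [o m m1 mM]; exact: functor_eq_refl.
apply: (bar_data_eq (e := e)).
rewrite (_ : eqhom _ = idm (s ord0)); last exact: (eqhom1 (C := D)).
by rewrite sf_map1 /= nerve_mor1 sf_map1.
Qed.

End Chains.

(** * Compatibility of the projection and of [zeta] with the action of the group *)

Section Equivariance.
Variables (gT : finGroupType) (D C : Gcategory gT) (S : functor D C).
Hypothesis hS : equivariant S.
Variable F : right_Gfunctor D.

Local Notation YG := (hocolim (RightGFunctor (pushdown_axioms hS F))).
Local Notation BG := (hocolim F).
Local Notation YT := (tensor (pushdown S F) (nerve_under C)).
Local Notation BT := (tensor F (nerve_under D)).
Local Notation Ycls N := (quot_pi (@tensor_rel C (pushdown S F) (nerve_under C) N)).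
Local Notation Bcls N := (quot_pi (@tensor_rel D F (nerve_under D) N)).

Lemma Ycls_act g n (s : nerve D n) (x : F (s ord0) n) c
    (f : hom (S (s ord_max)) c) (sg : nerve (undercat c) n) :
  gs_act YG g n (Ycls n (tpair (F := pushdown S F) (T := nerve_under C)
    (c := c) (bar_mk (T := homS S c) x f) sg)) =
  Ycls n (tpair (F := pushdown S F) (T := nerve_under C) (c := gact C g c)
    (bar_mk (T := homS S (gact C g c)) (s := compF (gact D g) s)
       (rg_eta F g (s ord0) n x) (homS_act hS g f))
    (compF (under_map (gact C g) c) sg : nerve (undercat (gact C g c)) n)).
Proof.
exact: (@tensor_act_funE gT C (RightGFunctor (pushdown_axioms hS F))
  (nerve_underG C)).
Qed.

Lemma collapse_act g n (y : YT n) :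
  collapse S F n (gs_act YG g n y) = gs_act BG g n (collapse S F n y).
Proof.
elim/Y_ind: y => s x c f sg.
rewrite Ycls_act [collapse S F n _]collapse_funE.
have -> : collapse S F n (Ycls n (tpair (F := pushdown S F) (T := nerve_under C) (c := c)
  (bar_mk (T := homS S c) x f) sg)) =
  Bcls n (tpair (F := F) (T := nerve_under D) x (base_chain s)) by exact: collapse_funE.
apply: esym; apply: (etrans (@tensor_act_funE gT D F (nerve_underG D) g n _)).
congr (Bcls n (tpair _ _)).
apply: (@undercat_functor_eq _ D (gact D g (s ord0))
  (compF (under_map (gact D g) (s ord0)) (base_chain s))
  (base_chain (compF (gact D g) s)) (fun=> erefl)) => [i|i j ij] /=.
  by rewrite comp1m.
by rewrite comp1m compm1.
Qed.

Lemma zeta_act g n (y : YT n) N k :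
  zeta_fun (gs_act YG g n y) k = gs_act YG g N (@zeta_fun D C S F n y N k).
Proof.
elim/Y_ind: y => s x c f sg; rewrite Ycls_act !zeta_funE.
set ab := pair_chain_ok k; move: (proj1_sig k).1 (_ \o _) ab => a b ab.
rewrite [RHS]Ycls_act present_repr; congr (Ycls N).
set s' := compF (gact D g) s; set f' := homS_act hS g f.
set sg' := compF (under_map (gact C g) c) sg.
have e : sop a (s' : nerve D n) = compF (gact D g) (sop a s : nerve D N) :> nerve D N.
  exact: functor_eq_refl.
apply: (present_eq (e := e)).
  rewrite (_ : eqhom _ = idm (s' (a ord0))); last exact: (eqhom1 (C := D)).
  by rewrite sf_map1 (eta_nat (rg_axioms F)) (smap_nat (rg_eta F g (s ord0))).
rewrite (_ : @eqhom (op C) _ _ _ = idm (S (s' (a ord_max)) : op C)); last first.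
  exact: (eqhom1 (C := op C)).
rewrite sf_map1.
(* On the first copy the objects agree by equivariance of [S], on the second one by computation;
   [homS_act] contains the same transport, so the maps between the copies correspond. *)
pose ob_e (u : 'I_n.+1 + 'I_n.+1) :
    tot_ob S s' sg' u = gact C g (tot_ob S s sg u) :=
  match u with inl i => functor_ob_eq (hS g) (s i) | inr _ => erefl end.
have key (u v : 'I_n.+1 + 'I_n.+1) (uv : tot_le u v) :
    eqhom (ob_e v) \oc tot_mor (s := s') f' sg' uv =
    fmor (gact C g) (tot_mor (s := s) f sg uv) \oc eqhom (ob_e u).
  case: u v uv => i [] j ij //; rewrite /tot_mor /=.
  - exact: (functor_hom_eq (hS g) (fmor s _)).
  - rewrite comp1m !fmorM -!compmA; congr (_ \oc _).
    rewrite /f' /homS_act; congr (_ \oc _).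
    exact: (functor_hom_eq (hS g) (fmor s _)).
  - by rewrite comp1m compm1.
apply: (@undercat_functor_eq _ C (S (s' (a ord_max))) (chain (s := s') f' sg' ab)
  (compF (under_pre (homS_act hS g (idm (S (s (a ord_max))))))
     (compF (under_map (gact C g) _) (chain f sg ab))) (fun i => ob_e (b i)))
  => [i|i j ij].
  rewrite (key (inl (a ord_max)) _ (proj2 ab i)) /= /homS_act fmor1 comp1m.
  by [].
exact: key.
Qed.

End Equivariance.

Theorem theorem6p4 (R : realType) (gT : finGroupType) (D C : Gcategory gT)
    (S : functor D C) (hS : equivariant S) (F : right_Gfunctor D) :
  exists h : is_right_Gfunctor (pushdown_eta hS F),
    G_homotopy_equivalent R (hocolim (RightGFunctor h)) (hocolim F).
Proof.
exists (pushdown_axioms hS F).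
apply: (@zeta_equivalence R gT
  (hocolim (RightGFunctor (pushdown_axioms hS F))) (hocolim F)
  (collapse S F) (@sec D C S F) (@zeta D C S F)).
- exact: collapse_act.
- exact: secK.
- move=> m n a y N k l; exact: zeta_fun_sop.
- move=> n y k; exact: zeta_fun_id.
- move=> g n y N k; exact: zeta_act.
- move=> n y N k; exact: collapse_zeta_fun.
- move=> n y N k; exact: zeta_fun_low.
Qed.
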